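(* Let $m$ be an odd positive integer, $k\ge0$ an integer, $N=k+\frac{m-1}{2}$, $\alpha\in\mathbb R$, and let $P_k(\underline x)$ be an $\mathbb R_{0,m}$-valued homogeneous polynomial of degree $k$ on $\mathbb R^m$ with $\partial_{\underline x}P_k=0$. Then \[\mathsf{Ft}\left[\left(1+z^2\right)^{\alpha+N},P_k(\underline x)\right](x_0,\underline x)=(-2)^{N}(2k+m-1)!!\left(\prod_{j=1}^{N}(\alpha+j)\right)\mathsf{CK}\left[\left(1-|\underline x|^2\right)^\alpha P_k(\underline x)\right](x_0,\underline x).\]
   Context: $\mathbb R_{0,m}$ is the real Clifford algebra generated by $e_1,\dots,e_m$ with $e_je_k+e_ke_j=-2\delta_{jk}$; $\underline x\in\mathbb R^m$ is identified with $\sum_j x_je_j$. Write $r=|\underline x|$, $\underline\omega=\underline x/r$; points of $\mathbb R^{m+1}$ are $(x_0,\underline x)$. Dirac operator $\partial_{\underline x}=\sum_{j=1}^m e_j\partial_{x_j}$; a $C^1$ $\mathbb R_{0,m}$-valued function $f$ on an open subset of $\mathbb R^{m+1}$ is monogenic if $(\partial_{x_0}+\partial_{\underline x})f=0$. For $g$ real-analytic and $\mathbb R_{0,m}$-valued on an open $\underline\Omega\subset\mathbb R^m$, $\mathsf{CK}[g](x_0,\underline x)=\sum_{n\ge0}\frac{(-x_0)^n}{n!}\partial_{\underline x}^ng(\underline x)$ is its unique monogenic extension to a neighbourhood of $\underline\Omega$ in $\mathbb R^{m+1}$; here $g=(1-|\underline x|^2)^\alpha P_k$ on $|\underline x|<1$.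 Fueter map: for $h(z)=u(x,y)+iv(x,y)$ holomorphic on an open subset $\Xi$ of the upper half plane, $\mathsf{Ft}[h(z),P_k(\underline x)](x_0,\underline x)=\Delta^{k+\frac{m-1}{2}}[(u(x_0,r)+\underline\omega\,v(x_0,r))P_k(\underline x)]$ with $\Delta=\sum_{j=0}^m\partial_{x_j}^2$, defined where $(x_0,r)\in\Xi$. The power $(1+z^2)^{\gamma}$ with real exponent is the principal branch, given for $|z|<1$ by the binomial series $\sum_{n\ge0}\binom{\gamma}{n}z^{2n}$; the identity is understood near points $(0,\underline x)$ with $0<|\underline x|<1$. Double factorials use $(-1)!!=0!!=1$. *)

(* Defs.v *)
From mathcomp Require Import all_boot all_order all_algebra.
From mathcomp Require Import all_classical all_reals all_analysis.
Set Implicit Arguments. Unset Strict Implicit. Unset Printing Implicit Defensive.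
Import Order.TTheory GRing.Theory Num.Theory.
Import numFieldNormedType.Exports.
Local Open Scope ring_scope.

Section Clifford.
Variables (R : realType) (m : nat).

(* The real Clifford algebra R_{0,m}: an element is its family of coordinates
   on the basis blades e_A, A ⊆ {0,..,m-1} (e_∅ = 1, e_{j1<...<jl} = e_j1...e_jl). *)
Definition Cl := {set 'I_m} -> R.

(* e_A e_B = (-1)^{#{(a,b) in AxB | a > b}} (-1)^{|A∩B|} e_{A Δ B},
   which encodes e_j e_k + e_k e_j = -2 δ_jk. *)
Definition blade_sign (A B : {set 'I_m}) : R :=
  (-1) ^+ (#|[set p : 'I_m * 'I_m | (p.1 \in A) && (p.2 \in B) && (p.2 < p.1)%N]|
           + #|A :&: B|).

Definition symdiff (A B : {set 'I_m}) : {set 'I_m} := (A :\: B) :|: (B :\: A).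

Definition clmul (a b : Cl) : Cl := fun C =>
  \sum_(A : {set 'I_m}) \sum_(B : {set 'I_m} | symdiff A B == C)
     blade_sign A B * a A * b B.

Definition cladd (a b : Cl) : Cl := fun A => a A + b A.
Definition clscale (r : R) (a : Cl) : Cl := fun A => r * a A.
Definition clscal (r : R) : Cl := fun A => if A == finset.set0 then r else 0.
Definition cle (j : 'I_m) : Cl := fun A => if A == [set j] then 1 else 0.
Definition clvec (x : 'I_m -> R) : Cl := fun A => \sum_j x j * cle j A.

Definition normx (x : 'I_m -> R) : R := Num.sqrt (\sum_j x j ^+ 2).

Definition upd (x : 'I_m -> R) (j : 'I_m) (t : R) : 'I_m -> R :=
  fun i => if i == j then t else x i.

Definition pdx (j : 'I_m) (g : ('I_m -> R) -> Cl) : ('I_m -> R) -> Cl :=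
  fun x A => derive1 (fun t => g (upd x j t) A) (x j).

Definition dirac_op (g : ('I_m -> R) -> Cl) : ('I_m -> R) -> Cl :=
  fun x A => \sum_j clmul (cle j) (pdx j g x) A.

Definition pd0 (F : R -> ('I_m -> R) -> Cl) : R -> ('I_m -> R) -> Cl :=
  fun x0 x A => derive1 (fun t => F t x A) x0.
Definition pdj (j : 'I_m) (F : R -> ('I_m -> R) -> Cl) : R -> ('I_m -> R) -> Cl :=
  fun x0 => pdx j (F x0).

Definition lap (F : R -> ('I_m -> R) -> Cl) : R -> ('I_m -> R) -> Cl :=
  fun x0 x A => pd0 (pd0 F) x0 x A + \sum_j pdj j (pdj j F) x0 x A.

Definition CK (g : ('I_m -> R) -> Cl) : R -> ('I_m -> R) -> Cl :=
  fun x0 x A => limn (series (fun n : nat =>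
     (- x0) ^+ n / (n`!)%:R * iter n dirac_op g x A)).

Definition is_hpoly (k : nat) (P : ('I_m -> R) -> Cl) : Prop :=
  exists c : {ffun 'I_m -> 'I_k.+1} -> Cl,
    forall x A, P x A =
      \sum_(a : {ffun 'I_m -> 'I_k.+1} | (\sum_j (a j : nat))%N == k)
         c a A * \prod_j x j ^+ (a j).

(* Fueter map: Ft[h, P](x0,x) = Δ^N [(u(x0,r) + ω v(x0,r)) P(x)], N = k+(m-1)/2,
   with h = u + i v given by its real and imaginary parts. *)
Definition Ft (N : nat) (u v : R -> R -> R) (P : ('I_m -> R) -> Cl)
  : R -> ('I_m -> R) -> Cl :=
  iter N lap (fun y0 y =>
    clmul (cladd (clscal (u y0 (normx y)))
                 (clscale (v y0 (normx y) / normx y) (clvec y)))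
          (P y)).

End Clifford.

Definition cpow (R : realType) (x y : R) (n : nat) : R * R :=
  iter n (fun p : R * R => (x * p.1 - y * p.2, x * p.2 + y * p.1)) (1, 0).

Definition gbinom (R : realType) (g : R) (n : nat) : R :=
  (\prod_(i < n) (g - i%:R)) / (n`!)%:R.

(* real and imaginary parts of (1+z^2)^g (principal branch), z = x + i y,
   via the binomial series sum_n binom(g,n) z^{2n}, valid for |z| < 1 *)
Definition binom_re (R : realType) (g : R) (x y : R) : R :=
  limn (series (fun n => gbinom g n * (cpow x y (2 * n)).1)).
Definition binom_im (R : realType) (g : R) (x y : R) : R :=
  limn (series (fun n => gbinom g n * (cpow x y (2 * n)).2)).

Fixpoint dfact (n : nat) : nat :=
  match n with
  | 0 => 1
  | 1 => 1
  | S (S p as q) => (n * dfact p)%N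
  end.

(* Main.v *)
Require Import Defs.
From mathcomp Require Import all_boot all_order all_algebra.
From mathcomp Require Import all_classical all_reals all_analysis.
From mathcomp Require Import ring lra zify.
Import Order.TTheory GRing.Theory Num.Theory.
Import numFieldNormedType.Exports.
Local Open Scope ring_scope.
Set Implicit Arguments.
Unset Strict Implicit.
Unset Printing Implicit Defensive.

(** With s = |x|^2, both sides are of the form a(x_0, s) P_k + b(x_0, s) x P_k.
    On such functions the Laplacian and the Dirac operator become
    differential operators in x_0 and s alone, because P_k and x P_k are harmonic and
    homogeneous.  If (a, b) solves the Vekua system
      d_0 a = 2 s d_s b + (2 M + 1) b,   d_0 b = - 2 d_s a,
    then (d_s a, d_s b) solves it with M + 1, and the Laplacian of
    a P_k + b x P_k is 4 (N - M) (d_s a P_k + d_s b x P_k).  A holomorphic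
    u + i v gives a solution (u, v / r) with M = 0, so Delta^N multiplies
    d_s^N by 4^N N! = 2^N (2 N)!! and lands in the system M = N, which expresses
    monogenicity and which the Cauchy-Kovalevskaya extension also satisfies.
    Solutions being determined by their restriction to x_0 = 0, it remains to
    differentiate (1 - s)^(alpha + N) N times in s. *)

(** * Left multiplication by vectors in the Clifford algebra *)

Section CliffordMultiplication.
Variables (R : realType) (m : nat).
Implicit Types (i j : 'I_m) (c : Cl R m) (A B C : {set 'I_m}).

(** Since [derive1] and [limn] are total, no rule applies before derivability and convergence are
    known. Both sides are therefore written with double power series in x_0 and s whose coefficients
    obey Cauchy bounds on every smaller polydisc. These bounds survive d_0, d_s and s d_s without
    loss of domain, so every differential identity reduces to one between coefficients. The
    polydiscs satisfy X0 + sqrt S0 <= 1: splitting (x_0 + i r)^n by the binomial theorem costs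
    (|x_0| + r)^n in absolute value. Such polydiscs still reach a neighbourhood of each (0, x) with
    |x| < 1. The factor v / r is a power series in r^2, which removes the square root and the
    division by r; the formulas then hold on full balls, the origin included. Two multiples P_k and
    x P_k suffice because the Dirac operator kills the first and sends the second to -(2 k + m) P_k.
    Oddness of m gives 2 k + m = 2 N + 1 with N a natural number, so that N steps M -> M + 1 lead
    exactly from holomorphy to monogenicity. *)

Definition clmule j c : Cl R m := clmul (cle R j) c.

Lemma in_symdiff A B i : (i \in symdiff A B) = (i \in A) (+) (i \in B).
Proof.
by rewrite finset.in_setU !finset.in_setD; case: (i \in A); case: (i \in B).
Qed.

Lemma symdiffK A : involutive (symdiff A).
Proof. by move=> B; apply/setP => i; rewrite !in_symdiff addbA addbb. Qed.

Lemma symdiffCA A B C : symdiff A (symdiff B C) = symdiff B (symdiff A C).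
Proof. by apply/setP => i; rewrite !in_symdiff addbCA. Qed.

(** Because [symdiff [set j]] is an involution, a single blade contributes to each coordinate: left
    multiplication by e_j is a signed permutation of coordinates. *)
Lemma clmuleE j c C :
  clmule j c C = blade_sign R [set j] (symdiff [set j] C) *
    c (symdiff [set j] C).
Proof.
rewrite /clmule /clmul (bigD1 [set j]) //= [X in _ + X]big1 ?addr0.
  rewrite (bigD1 (symdiff [set j] C)) ?symdiffK //= big1 ?addr0.
    by rewrite /cle eqxx mulr1.
  by move=> B /andP[/eqP <-]; rewrite symdiffK eqxx.
by move=> B /negbTE Bj; rewrite big1 // => A _; rewrite /cle Bj mulr0 mul0r.
Qed.

(** The sign for passing the b < j and the sign of e_j^2 = -1 merge into one condition b <= j. The
    product form makes the sign multiplicative under [symdiff]. *)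
Lemma blade_sign1E j B :
  blade_sign R [set j] B = \prod_(b : 'I_m | (b <= j)%N) (-1) ^+ (b \in B).
Proof.
have -> : blade_sign R [set j] B =
    (-1) ^+ (#|[set b : 'I_m | (b \in B) && (b < j)%N]| + (j \in B)).
  rewrite /blade_sign; congr (_ ^+ (_ + _)%N).
    rewrite -(@card_imset _ _ (fun b : 'I_m => (j, b))); last by move=> a b [].
    apply: eq_card => -[a b]; rewrite finset.in_set /= finset.in_set1.
    apply/andP/imsetP => [[/andP[/eqP -> bB] bj]|[b' + [-> ->]]].
      by exists b; rewrite ?finset.in_set ?bB.
    by rewrite finset.in_set eqxx => /andP[].
  have -> : [set j] :&: B = if j \in B then [set j] else finset.set0.
    apply/setP => i; rewrite finset.in_setI finset.in_set1.
    case: eqP => [->|ij]; case: ifP;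
      rewrite ?finset.in_set1 ?eqxx ?finset.in_set0 //.
    by move/eqP/negbTE: ij => ->.
  by case: ifP; rewrite ?cards1 ?cards0.
rewrite [RHS](bigD1 j) //= mulrC exprD; congr (_ * _).
rewrite -sum1dep_card -prodrXr big_mkcond [RHS]big_mkcond /=.
apply: eq_bigr => b _; rewrite -val_eqE andbC /= ltn_neqAle [_ && (b <=
  j)%N]andbC.
by case: (_ && (b != j)); case: (b \in B).
Qed.

Lemma blade_sign1_symdiff i j B :
  blade_sign R [set j] (symdiff [set i] B) =
  (-1) ^+ (i <= j)%N * blade_sign R [set j] B.
Proof.
rewrite !blade_sign1E.
under eq_bigr do rewrite in_symdiff signr_addb finset.in_set1.
rewrite big_split /=; congr (_ * _).
case: (leqP i j) => ij.
  rewrite (bigD1 i) //= eqxx big1 ?mulr1 // => b /andP[_ /negbTE ->].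
  by rewrite expr0.
rewrite big1 // => b bj; case: eqP => [bi|//].
by move: bj; rewrite bi leqNgt ij.
Qed.

(** Both orders reach the same blade, with signs differing by the parities of i <= j and j <= i,
    exactly one of which holds. *)
Lemma clmule_anticomm i j c C : i != j ->
  clmule i (clmule j c) C = - clmule j (clmule i c) C.
Proof.
move=> ij; rewrite !clmuleE [symdiff [set j] (symdiff _ _)]symdiffCA.
rewrite !blade_sign1_symdiff !leqnn !mulrA -mulNr; congr (_ * _).
have -> : (j <= i)%N = ~~ (i <= j)%N.
  by rewrite -ltnNge leq_eqVlt; move: ij;
    rewrite -val_eqE eq_sym /= => /negbTE ->.
by case: leqP => _ /=; ring.
Qed.

Lemma clmuleK j c C : clmule j (clmule j c) C = - c C.
Proof.
rewrite !clmuleE symdiffK blade_sign1_symdiff leqnn /=.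
have ss : blade_sign R [set j] C ^+ 2 = 1.
  by rewrite blade_sign1E -prodrXl big1 // => b _; rewrite sqrr_sign.
transitivity (- (blade_sign R [set j] C ^+ 2) * c C); first by ring.
by rewrite ss mulN1r.
Qed.

Lemma clmule_sum j I (r : seq I) (a : I -> R) (c : I -> Cl R m) C :
  clmule j (fun A => \sum_(i <- r) a i * c i A) C =
  \sum_(i <- r) a i * clmule j (c i) C.
Proof.
by rewrite clmuleE mulr_sumr; apply: eq_bigr => i _; rewrite clmuleE mulrCA.
Qed.

Lemma clmuleD j (a b : R) (c d : Cl R m) C :
  clmule j (fun A => a * c A + b * d A) C = a * clmule j c C + b * clmule j d C.
Proof. by rewrite !clmuleE; ring. Qed.

Definition clmulv (x : 'I_m -> R) c : Cl R m :=
  fun A => \sum_j x j * clmule j c A.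

Lemma clmul_paravector (a b : R) (x : 'I_m -> R) c A :
  clmul (cladd (clscal a) (clscale b (clvec x))) c A =
  a * c A + b * clmulv x c A.
Proof.
have clmulD (u v : Cl R m) : clmul (cladd u v) c A = clmul u c A + clmul v c A.
  rewrite /clmul -big_split; apply: eq_bigr => C _; rewrite -big_split.
  by apply: eq_bigr => D _; rewrite /cladd mulrDr mulrDl.
rewrite clmulD; congr (_ + _).
  rewrite /clmul (bigD1 finset.set0) //= [X in _ + X]big1 ?addr0; last first.
    by move=> B /negbTE Bj; rewrite big1 // => C _;
      rewrite /clscal Bj mulr0 mul0r.
  rewrite (bigD1 A) /=; last by apply/eqP/setP => i;
    rewrite in_symdiff finset.in_set0.
  rewrite big1 ?addr0 => [|B /andP[/eqP <-]]; last first.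
    by case/eqP; apply/setP => i; rewrite in_symdiff finset.in_set0.
  rewrite /clscal eqxx /blade_sign !eq_card0 ?mul1r //.
    by move=> i; rewrite finset.in_setI finset.in_set0.
  by move=> p; rewrite finset.in_set finset.in_set0.
rewrite /clmulv /clmule /clmul mulr_sumr.
under [RHS]eq_bigr do rewrite !mulr_sumr.
rewrite exchange_big /=; apply: eq_bigr => B _.
under [RHS]eq_bigr do rewrite !mulr_sumr.
rewrite exchange_big /=; apply: eq_bigr => C _.
rewrite /clscale /clvec mulr_sumr mulr_sumr mulr_suml.
by apply: eq_bigr => j _; ring.
Qed.

(** Adding the double sum to its transpose cancels the off-diagonal terms by anticommutation; hence
    the multiplication by 2. *)
Lemma clmulvK (x : 'I_m -> R) c A :
  clmulv x (clmulv x c) A = - (\sum_j x j ^+ 2) * c A.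
Proof.
rewrite /clmulv; under eq_bigr do rewrite clmule_sum mulr_sumr.
apply: (@mulfI _ 2); first by rewrite pnatr_eq0.
rewrite mulr_natl mulr2n [X in X + _]exchange_big /= -big_split /=.
rewrite mulNr mulr_suml mulrN mulr_sumr -sumrN; apply: eq_bigr => i _.
rewrite -big_split (bigD1 i) //= big1 ?addr0 => [|j ji].
  by rewrite clmuleK; ring.
by rewrite (clmule_anticomm _ _ ji); ring.
Qed.

Lemma clmule_vec j (x : 'I_m -> R) c A :
  clmule j (clmulv x c) A = - clmulv x (clmule j c) A - 2 * x j * c A.
Proof.
rewrite clmule_sum /clmulv (bigD1 j) //= [in RHS](bigD1 j) //= clmuleK.
have -> : \sum_(i < m | i != j) x i * clmule j (clmule i c) A =
          - \sum_(i < m | i != j) x i * clmule i (clmule j c) A.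
  by rewrite -sumrN; apply: eq_bigr => i /clmule_anticomm ->; ring.
by ring.
Qed.

End CliffordMultiplication.

(** * Geometrically dominated simple and double series *)

Section DominatedSeries.
Local Open Scope classical_set_scope.
Variable R : realType.
Implicit Types (u : nat -> R) (t : nat -> nat -> R) (C q x y : R).

Lemma cvg_series_shift n u : cvgn (series (fun i => u (i + n)%N)) ->
  series u @ \oo --> series u n + limn (series (fun i => u (i + n)%N)).
Proof.
move=> cu; rewrite -(cvg_shiftn n).
rewrite [X in X @ _](_ : _ =
    (fun k => series u n + series (fun i => u (i + n)%N) k)).
  by apply: cvgD => //; exact: cvg_cst.
apply/funext => k; rewrite /series /= (big_cat_nat _ (n := n)) ?leq_addl //=.
by rewrite -{2}[n]add0n big_addn addnK.
Qed.

Lemma geometric_cvg u C q : 0 <= q < 1 -> (forall n, `|u n| <= C * q ^+ n) ->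
  cvgn (series u).
Proof.
move=> /andP[q0 q1] uC; apply: normed_cvg.
have C0 : 0 <= C by have := uC 0%N; rewrite expr0 mulr1; apply: le_trans.
apply: (series_le_cvg (v_ := geometric C q)) => //.
- by move=> n /=.
- by move=> n; exact: geometric_ge0.
- by apply: is_cvg_geometric_series; rewrite ger0_norm.
Qed.

Lemma geometric_norm_lim u C q : 0 <= q < 1 ->
  (forall n, `|u n| <= C * q ^+ n) -> `|limn (series u)| <= C / (1 - q).
Proof.
move=> q01 uC; have /andP[q0 q1] := q01.
have cn : cvgn [normed series u].
  by apply: (geometric_cvg q01 (C := C)) => n; rewrite normr_id.
have cg : cvgn (series (geometric C q)).
  by apply: is_cvg_geometric_series; rewrite ger0_norm.
apply: le_trans (lim_series_norm cn) _.
have <- : limn (series (geometric C q)) = C / (1 - q).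
  by apply: cvg_lim => //; apply: cvg_geometric_series; rewrite ger0_norm.
exact: lim_series_le.
Qed.

Lemma geometric_tail u C q n : 0 <= q < 1 ->
  (forall n, `|u n| <= C * q ^+ n) ->
  `|limn (series u) - series u n| <= C * q ^+ n / (1 - q).
Proof.
move=> q01 uC.
have uCn i : `|u (i + n)%N| <= (C * q ^+ n) * q ^+ i.
  by rewrite -mulrA -exprD addnC.
have cu := geometric_cvg q01 uCn.
rewrite (cvg_lim _ (cvg_series_shift cu)) // addrC addKr.
exact: geometric_norm_lim.
Qed.

(** Square partial sums are symmetric in the two indices, so both iterated sums will be limits of
    the same sequence. Cutting row p at n costs at most C x^p y^n / (1 - y), which is summable in p
    and tends to 0 with n. *)
Lemma square_sum_cvg t C x y : 0 <= x < 1 -> 0 <= y < 1 ->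
  (forall p l, `|t p l| <= C * x ^+ p * y ^+ l) ->
  (fun n => \sum_(0 <= p < n) \sum_(0 <= l < n) t p l) @ \oo -->
    limn (series (fun p => limn (series (t p)))).
Proof.
move=> x01 y01 tC; have /andP[x0 x1] := x01; have /andP[y0 y1] := y01.
have C0 : 0 <= C by have := tC 0%N 0%N; rewrite !expr0 !mulr1; apply: le_trans.
pose L p := limn (series (t p)).
have LC p : `|L p| <= C / (1 - y) * x ^+ p.
  have := geometric_norm_lim y01 (tC p); rewrite /L => /le_trans; apply.
  by rewrite mulrAC.
have cL := geometric_cvg x01 LC.
apply: cvg_sub0 cL.
apply: (@squeeze_cvgr _ _ _ _ (fun n => - (C / (1 - x) / (1 - y) * y ^+ n))
   (fun n => C / (1 - x) / (1 - y) * y ^+ n)).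
- near=> n; rewrite -ler_norml.
  change (`|\sum_(0 <= p < n) \sum_(0 <= l < n) t p l -
    \sum_(0 <= p < n) L p| <= C / (1 - x) / (1 - y) * y ^+ n).
  rewrite -sumrB; apply: le_trans (ler_norm_sum _ _ _) _.
  apply: (@le_trans _ _ (\sum_(0 <= p < n) C / (1 - y) * y ^+ n * x ^+ p)).
    apply: ler_sum => p _; rewrite distrC.
    apply: le_trans (geometric_tail n y01 (tC p)) _.
    by rewrite le_eqVlt; apply/orP; left; apply/eqP; ring.
  have := @geometric_seriesE R (C / (1 - y) * y ^+ n) x; rewrite lt_eqF //.
  move=> /(_ isT) /(congr1 (fun f => f n)); rewrite /series /= => ->.
  have -> : C / (1 - x) / (1 - y) * y ^+ n =
      C / (1 - y) * y ^+ n * 1 / (1 - x) by ring.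
  rewrite ler_pM2r ?invr_gt0 ?subr_gt0 //.
  apply: ler_wpM2l; last by rewrite gerBl exprn_ge0.
  by rewrite mulr_ge0 ?exprn_ge0 // divr_ge0 // subr_ge0 ltW.
- rewrite -[X in _ --> X]oppr0; apply: cvgN; apply: cvg_geometric.
  by rewrite ger0_norm.
- by apply: cvg_geometric; rewrite ger0_norm.
Unshelve. all: by end_near. Qed.

Lemma double_series_exchange t C x y : 0 <= x < 1 -> 0 <= y < 1 ->
  (forall p l, `|t p l| <= C * x ^+ p * y ^+ l) ->
  limn (series (fun p => limn (series (t p)))) =
  limn (series (fun l => limn (series (t^~ l)))).
Proof.
move=> x01 y01 tC.
have c1 := square_sum_cvg x01 y01 tC.
have c2 : (fun n => \sum_(0 <= l < n) \sum_(0 <= p < n) t p l) @ \oo -->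
    limn (series (fun l => limn (series (t^~ l)))).
  by apply: (square_sum_cvg y01 x01 (C := C)) => l p; rewrite mulrAC.
have <- := cvg_lim (@norm_hausdorff _ _) c1; rewrite -(cvg_lim _ c2) //.
by congr (limn _); apply/funext => n; rewrite exchange_big.
Qed.

(* With weights [2 l + e], an antidiagonal is a row of the array
   [(n, l) |-> t (n - (2 l + e)) l]. *)
Lemma diagonal_series t e C x y : 0 <= x < 1 -> 0 <= y < 1 ->
  (forall p l, `|t p l| <= C * x ^+ p * y ^+ l) ->
  limn (series (fun n => \sum_(0 <= l < n.+1 | (2 * l + e <= n)%N)
     t (n - (2 * l + e))%N l)) =
  limn (series (fun p => limn (series (t p)))).
Proof.
(* After the reindexing n = p + 2 l + e the bound reads x^(-e) x^n (y / x^2)^l, geometric in l only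
   if y < x^2. Enlarging x keeps the domination: z^2 is the midpoint of max(x^2, y) and 1. *)
wlog [x0 yx] : x / 0 < x /\ y < x ^+ 2.
  move=> H /andP[x0 x1] /andP[y0 y1] tC.
  have C0 : 0 <= C by have := tC 0%N 0%N; rewrite !expr0 !mulr1;
    apply: le_trans.
  pose z := Num.sqrt ((1 + Num.max (x ^+ 2) y) / 2).
  have M1 : Num.max (x ^+ 2) y < 1 by rewrite gt_max y1 expr_lt1 ?x1.
  have M0 : 0 <= Num.max (x ^+ 2) y by rewrite le_max exprn_ge0.
  have zE : z ^+ 2 = (1 + Num.max (x ^+ 2) y) / 2 by rewrite sqr_sqrtr; lra.
  have xM : x ^+ 2 <= Num.max (x ^+ 2) y by rewrite le_max lexx.
  have yM : y <= Num.max (x ^+ 2) y by rewrite le_max lexx orbT.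
  have z0 : 0 < z by rewrite sqrtr_gt0; lra.
  have xz : x <= z.
    by rewrite -(@ler_pXn2r _ 2) ?nnegrE ?(ltW z0) // zE; lra.
  have yz : y < z ^+ 2 by rewrite zE; lra.
  apply: (H z) => //.
  - apply/andP; split; first exact: ltW.
    by rewrite -(@expr_lt1 _ 2) ?ltW // zE; lra.
  - by rewrite y0.
  - move=> p l; apply: le_trans (tC p l) _.
    by rewrite ler_wpM2r ?exprn_ge0 // ler_wpM2l // lerXn2r ?nnegrE // ltW.
move=> x01 y01 tC; have /andP[_ x1] := x01; have /andP[y0 y1] := y01.
have C0 : 0 <= C by have := tC 0%N 0%N; rewrite !expr0 !mulr1; apply: le_trans.
pose t' n l := if (2 * l + e <= n)%N then t (n - (2 * l + e))%N l else 0.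
have yx01 : 0 <= y / x ^+ 2 < 1.
  apply/andP; split; first by rewrite divr_ge0 // exprn_ge0 // ltW.
  by rewrite ltr_pdivrMr ?exprn_gt0 // mul1r.
have t'C n l : `|t' n l| <= C / x ^+ e * x ^+ n * (y / x ^+ 2) ^+ l.
  rewrite /t'; case: leqP => [len|_]; last first.
    have /andP[q0 _] := yx01; have x0' := ltW x0.
    by rewrite normr0 !mulr_ge0 // ?invr_ge0 exprn_ge0.
  apply: le_trans (tC _ _) _; rewrite le_eqVlt; apply/orP; left; apply/eqP.
  have -> : x ^+ n = x ^+ (n - (2 * l + e)) * (x ^+ 2) ^+ l * x ^+ e.
    by rewrite -exprM -!exprD -addnA subnK.
  rewrite expr_div_n; field.
  by rewrite !expf_neq0 // lt0r_neq0.
rewrite [LHS](_ : _ = limn (series (fun n => limn (series (t' n)))));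
  last first.
  congr (limn (series _)); apply/funext => n.
  rewrite big_mkcond /=; apply/esym/cvg_lim => //.
  apply: cvg_near_cst; exists n.+1 => // k /= nk.
  rewrite /series /= (big_cat_nat _ (n :=
    n.+1)) //= [X in _ + X]big1_seq ?addr0 //.
  move=> l /=; rewrite mem_index_iota => /andP[nl _].
  by rewrite /t'; suff /negbTE -> : ~~ (2 * l + e <= n)%N by []; lia.
(* Once both sides are summed by columns, column l of [t'] is column l of [t] preceded by 2 l + e
   zeros. *)
rewrite (double_series_exchange _ yx01 t'C) //.
rewrite (double_series_exchange x01 y01 tC); congr (limn (series _)).
apply/funext => l.
have cl : cvgn (series (fun n => t' (n + (2 * l + e))%N l)).
  apply: (geometric_cvg x01 (C := C * y ^+ l)) => n.
  by rewrite /t' leq_addl addnK mulrAC.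
rewrite (cvg_lim _ (cvg_series_shift cl)) //.
rewrite [X in X + _]big1_seq ?add0r => [|n /=]; last first.
  by rewrite mem_index_iota => /andP[_ nl]; rewrite /t' leqNgt nl.
by congr (limn (series _)); apply/funext => n; rewrite /t' leq_addl addnK.
Qed.

End DominatedSeries.

(** * Power series in one and two variables *)

Section PowerSeries.
Local Open Scope classical_set_scope.
Variable R : realType.
Implicit Types (f g : nat -> R) (a b : nat -> nat -> R) (x s X S c : R).

Definition psum f x : R := limn (pseries f x).

(** One constant serves a whole family: with [I = unit] this concerns a single series, with
    [I = nat] the rows of an array, so that the one-variable estimates also treat double series. *)
Definition cauchy_bounded (I : Type) S (F : I -> nat -> R) :=
  exists C, forall i n, `|F i n| * S ^+ n <= C.

Definition conv1 S0 f :=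
  forall S, 0 <= S < S0 -> cauchy_bounded S (fun _ : unit => f).

Definition conv2 X0 S0 a := forall X S, 0 <= X < X0 -> 0 <= S < S0 ->
  cauchy_bounded S (fun p l => a p l * X ^+ p).

Lemma cauchy_bounded_ge0 I (i : I) S (F : I -> nat -> R) C :
  (forall i n, `|F i n| * S ^+ n <= C) -> 0 <= C.
Proof. by move=> /(_ i 0%N); rewrite expr0 mulr1; apply: le_trans. Qed.

Lemma cauchy_bounded_le I S (F G : I -> nat -> R) : 0 <= S ->
  (forall i n, `|G i n| <= `|F i n|) ->
  cauchy_bounded S F -> cauchy_bounded S G.
Proof.
move=> S0 GF [C FC]; exists C => i n; apply: le_trans (FC i n).
by rewrite ler_wpM2r ?exprn_ge0.
Qed.

Lemma cauchy_boundedD I S (F G : I -> nat -> R) : 0 <= S ->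
  cauchy_bounded S F -> cauchy_bounded S G ->
  cauchy_bounded S (fun i n => F i n + G i n).
Proof.
move=> S0 [C FC] [D GD]; exists (C + D) => i n.
by rewrite (le_trans _ (lerD (FC i n) (GD i n))) // -mulrDl ler_wpM2r
  ?exprn_ge0 ?ler_normD.
Qed.

Lemma cauchy_boundedZ I S (F : I -> nat -> R) c :
  cauchy_bounded S F -> cauchy_bounded S (fun i n => c * F i n).
Proof.
by move=> [C FC]; exists (`|c| * C) => i n; rewrite normrM -mulrA ler_wpM2l.
Qed.

(** The factor n + 1 is paid for by shrinking the radius: factoring S'^(n+1) - S^(n+1) gives (n + 1)
    S^n (S' - S) <= S'^(n+1). *)
Lemma cauchy_bounded_weight I S S' (F : I -> nat -> R) : 0 <= S < S' ->
  cauchy_bounded S' F -> cauchy_bounded S (fun i n => n.+1%:R * F i n).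
Proof.
move=> /andP[S0 SS'] [C FC]; exists (C * S' / (S' - S)) => i n.
have dS : 0 < S' - S by rewrite subr_gt0.
have S'0 : 0 <= S' by rewrite ltW // (le_lt_trans S0).
rewrite ler_pdivlMr // normrM ger0_norm ?ler0n //.
have nS : n.+1%:R * S ^+ n * (S' - S) <= S' ^+ n * S'.
  apply: (@le_trans _ _ (S' ^+ n.+1 - S ^+ n.+1)); last first.
    by rewrite exprSr gerBl exprn_ge0.
  rewrite subrXX mulrC ler_wpM2l ?(ltW dS) // mulr_natl -[in X in X <=
    _](card_ord n.+1) -sumr_const.
  apply: ler_sum => j _ /=.
  have -> : S ^+ n = S ^+ (n - j) * S ^+ j by rewrite -exprD subnK // -ltnS.
  rewrite ler_wpM2r ?exprn_ge0 //.
  by rewrite lerXn2r ?nnegrE // ltW.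
have -> : n.+1%:R * `|F i n| * S ^+ n * (S' - S) =
    `|F i n| * (n.+1%:R * S ^+ n * (S' - S)) by ring.
apply: le_trans (ler_wpM2l (normr_ge0 _) nS) _.
by rewrite mulrA ler_wpM2r.
Qed.

Lemma cauchy_bounded_shift I S (F : I -> nat -> R) : 0 < S ->
  cauchy_bounded S F -> cauchy_bounded S (fun i n => F i n.+1).
Proof.
move=> S0 [C FC]; exists (C / S) => i n.
by rewrite ler_pdivlMr // -mulrA -exprSr.
Qed.

Lemma cauchy_bounded_diffs I S S' (F : I -> nat -> R) : 0 <= S < S' ->
  cauchy_bounded S' F -> cauchy_bounded S (fun i => pseries_diffs (F i)).
Proof.
(* The index shift divides by the radius, and S may be 0; the intermediate radius T is positive. *)
move=> /andP[S0 SS'] bF; set T := (S + S') / 2.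
have S0T : 0 <= S < T by rewrite S0 /T; lra.
have TS' : 0 <= T < S' by rewrite /T; lra.
have T0 : 0 < T by move: S0T TS'; lra.
have /(cauchy_bounded_shift T0) := cauchy_bounded_weight TS' bF.
move=> [C FC]; exists C => i n; apply: le_trans (FC i n).
apply: ler_pM => //; first by rewrite exprn_ge0.
  rewrite !normrM ler_wpM2r // !ger0_norm ?ler0n // ler_nat //.
by rewrite lerXn2r ?nnegrE // ltW //; case/andP: S0T.
Qed.

Lemma conv1_diffs S0 f : conv1 S0 f -> conv1 S0 (pseries_diffs f).
Proof.
move=> cf S /andP[SS SS0]; set S' := (S + S0) / 2.
have SS' : 0 <= S < S' by rewrite SS /S'; lra.
by apply: (cauchy_bounded_diffs SS'); apply: cf; rewrite /S'; lra.
Qed.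

Lemma conv1_weight S0 f : conv1 S0 f -> conv1 S0 (fun n => n%:R * f n).
Proof.
move=> cf S /andP[SS SS0]; set S' := (S + S0) / 2.
have SS' : 0 <= S < S' by rewrite SS /S'; lra.
have S'0 : 0 <= S' < S0 by rewrite /S'; lra.
have := cauchy_bounded_weight SS' (cf _ S'0);
  apply: cauchy_bounded_le => // _ n.
by rewrite !normrM ler_wpM2r // !ger0_norm ?ler0n // ler_nat.
Qed.

Lemma conv1D S0 f g : conv1 S0 f -> conv1 S0 g -> conv1 S0 (fun n => f n + g n).
Proof.
move=> cf cg S Sb; have /andP[SS _] := Sb.
exact: (cauchy_boundedD SS (cf S Sb) (cg S Sb)).
Qed.

Lemma conv1Z S0 f c : conv1 S0 f -> conv1 S0 (fun n => c * f n).
Proof. by move=> cf S Sb; apply: cauchy_boundedZ (cf S Sb). Qed.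

Lemma cauchy_bounded_geometric I S (F : I -> nat -> R) s : `|s| < S ->
  cauchy_bounded S F ->
  exists2 C, 0 <= `|s| / S < 1 &
    forall i n, `|F i n * s ^+ n| <= C * (`|s| / S) ^+ n.
Proof.
move=> sS [C FC]; have S0 : 0 < S by rewrite (le_lt_trans _ sS).
exists C; first by rewrite divr_ge0 ?(ltW S0) //= ltr_pdivrMr // mul1r.
move=> i n; rewrite normrM normrX expr_div_n mulrA ler_pdivlMr ?exprn_gt0 //.
by rewrite mulrAC ler_wpM2r ?exprn_ge0.
Qed.

Lemma conv1_cvg S0 f s : conv1 S0 f -> `|s| < S0 -> cvgn (pseries f s).
Proof.
move=> cf sS0; set S := (`|s| + S0) / 2; have s0 := normr_ge0 s.
have sS : `|s| < S by rewrite /S; lra.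
have Sb : 0 <= S < S0 by rewrite /S; lra.
have [C q01 fC] := cauchy_bounded_geometric sS (cf S Sb).
exact: (geometric_cvg q01 (fC tt)).
Qed.

Lemma psumD S0 f g s : conv1 S0 f -> conv1 S0 g -> `|s| < S0 ->
  psum (fun n => f n + g n) s = psum f s + psum g s.
Proof.
move=> cf cg sS0; rewrite /psum -lim_seriesD; try exact: conv1_cvg sS0.
by congr (limn (series _)); apply/funext => n /=; rewrite mulrDl.
Qed.

Lemma psumZ S0 f c s : conv1 S0 f -> `|s| < S0 ->
  psum (fun n => c * f n) s = c * psum f s.
Proof.
move=> cf sS0; rewrite /psum -[RHS]/(c *: _) -lim_seriesZ;
  last exact: conv1_cvg sS0.
by congr (limn (series _)); apply/funext => n /=; rewrite -mulrA.
Qed.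

Lemma is_derive_psum S0 f s : conv1 S0 f -> `|s| < S0 ->
  is_derive s (1 : R) (psum f) (psum (pseries_diffs f) s).
Proof.
move=> cf sS0; set S := (`|s| + S0) / 2; have s0 := normr_ge0 s.
have Sp : 0 <= S by rewrite /S; lra.
have SS0 : `|S| < S0 by rewrite ger0_norm // /S; lra.
apply: (@pseries_snd_diffs _ _ S).
- exact: conv1_cvg SS0.
- by apply: conv1_cvg SS0; exact: conv1_diffs.
- by apply: conv1_cvg SS0; do 2 apply: conv1_diffs.
- by rewrite [`|S|]ger0_norm // /S; lra.
Qed.

(** This is s d/ds on coefficients; it lets operators with the variable coefficient s act
    diagonally. *)
Lemma psum_weight S0 f s : conv1 S0 f -> `|s| < S0 ->
  psum (fun n => n%:R * f n) s = s * psum (pseries_diffs f) s.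
Proof.
move=> cf sS0; have cd := conv1_cvg (conv1_diffs cf) sS0.
have E : (fun i => (i + 1)%:R * f (i + 1)%N * s ^+ (i + 1)) =
    s *: (fun i => pseries_diffs f i * s ^+ i).
  by apply/funext => i; rewrite addn1 exprS -[RHS]/(s * _) /pseries_diffs; ring.
have cs : cvgn (series (fun i => (i + 1)%:R * f (i + 1)%N * s ^+ (i + 1))).
  by rewrite E; exact: is_cvg_seriesZ.
have := @cvg_series_shift _ 1 (fun i => i%:R * f i * s ^+ i) cs.
rewrite E lim_seriesZ // /series /= big_nat1 !mul0r add0r => H.
by rewrite /psum; apply: cvg_lim H.
Qed.

End PowerSeries.

(** * Double power series in x_0 and s: Cauchy bounds and termwise derivatives *)

Section DoublePowerSeries.
Local Open Scope classical_set_scope.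
Variable R : realType.
Implicit Types (a b : nat -> nat -> R) (x s X S c : R).

Definition psum2 a x s : R := psum (fun p => psum (a p) s) x.

Definition diff0 a : nat -> nat -> R := fun p l => p.+1%:R * a p.+1 l.
Definition diffs a : nat -> nat -> R := fun p l => l.+1%:R * a p l.+1.

Lemma conv2_swap X0 S0 a : conv2 X0 S0 a -> conv2 S0 X0 (fun l p => a p l).
Proof.
move=> ca S X Sb Xb; have [C aC] := ca X S Xb Sb; exists C => l p.
have /andP[S00 _] := Sb; have /andP[X00 _] := Xb.
apply: le_trans (aC p l); rewrite !normrM !normrX.
by rewrite (ger0_norm S00) (ger0_norm X00) mulrAC.
Qed.

Lemma conv2_le X0 S0 a b : (forall p l, `|b p l| <= `|a p l|) ->
  conv2 X0 S0 a -> conv2 X0 S0 b.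
Proof.
move=> ba ca X S Xb Sb; have /andP[S00 _] := Sb.
apply: cauchy_bounded_le S00 _ (ca X S Xb Sb) => p l.
by rewrite !normrM ler_wpM2r.
Qed.

Lemma conv2D X0 S0 a b : conv2 X0 S0 a -> conv2 X0 S0 b ->
  conv2 X0 S0 (fun p l => a p l + b p l).
Proof.
move=> ca cb X S Xb Sb; have /andP[S00 _] := Sb.
apply: cauchy_bounded_le S00 _ (cauchy_boundedD S00 (ca X S Xb Sb) (cb X S Xb
  Sb)).
by move=> p l; rewrite mulrDl.
Qed.

Lemma conv2Z X0 S0 a c : conv2 X0 S0 a -> conv2 X0 S0 (fun p l => c * a p l).
Proof.
move=> ca X S Xb Sb; have /andP[S00 _] := Sb.
apply: cauchy_bounded_le S00 _ (cauchy_boundedZ c (ca X S Xb Sb)).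
by move=> p l; rewrite mulrA.
Qed.

Lemma conv2_diffs X0 S0 a : conv2 X0 S0 a -> conv2 X0 S0 (diffs a).
Proof.
move=> ca X S Xb /andP[SS SS0]; set S' := (S + S0) / 2.
have SS' : 0 <= S < S' by rewrite SS /S'; lra.
have Sb' : 0 <= S' < S0 by rewrite /S'; lra.
apply: cauchy_bounded_le SS _ (cauchy_bounded_diffs SS' (ca X S' Xb Sb')).
by move=> p l; rewrite /diffs /pseries_diffs mulrA.
Qed.

Lemma conv2_weight X0 S0 a : conv2 X0 S0 a ->
  conv2 X0 S0 (fun p l => l%:R * a p l).
Proof.
move=> ca X S Xb /andP[SS SS0]; set S' := (S + S0) / 2.
have SS' : 0 <= S < S' by rewrite SS /S'; lra.
have Sb' : 0 <= S' < S0 by rewrite /S'; lra.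
apply: cauchy_bounded_le SS _ (cauchy_bounded_weight SS' (ca X S' Xb Sb')).
move=> p l; rewrite !normrM mulrA !ler_wpM2r // !ger0_norm ?ler0n //.
by rewrite ler_nat.
Qed.

Lemma conv2_diff0 X0 S0 a : conv2 X0 S0 a -> conv2 X0 S0 (diff0 a).
Proof. by move=> /conv2_swap/conv2_diffs/conv2_swap. Qed.

Lemma conv2_col X0 S0 a p : 0 < X0 -> conv2 X0 S0 a -> conv1 S0 (a p).
Proof.
move=> X0p ca S Sb; have Xb : 0 <= X0 / 2 < X0 by lra.
have [C aC] := ca _ _ Xb Sb; have Xp : 0 < (X0 / 2) ^+ p by rewrite exprn_gt0;
  lra.
exists (C / (X0 / 2) ^+ p) => _ l; rewrite ler_pdivlMr //.
apply: le_trans (aC p l).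
by rewrite normrM (gtr0_norm Xp) mulrAC.
Qed.

Lemma conv2_row X0 S0 a s : conv2 X0 S0 a -> `|s| < S0 ->
  conv1 X0 (fun p => psum (a p) s).
Proof.
move=> ca sS0 X Xb; set S := (`|s| + S0) / 2; have s0 := normr_ge0 s.
have sS : `|s| < S by rewrite /S; lra.
have Sb : 0 <= S < S0 by rewrite /S; lra.
have [C q01 aC] := cauchy_bounded_geometric sS (ca X S Xb Sb).
have /andP[X00 XX0] := Xb.
exists (C / (1 - `|s| / S)) => _ p; rewrite -[X in _ *
  X]ger0_norm ?exprn_ge0 //.
rewrite -normrM mulrC -(psumZ _ (S0 := S0)) //.
  rewrite /psum; apply: geometric_norm_lim => // l /=.
  by rewrite [X ^+ p * _]mulrC.
apply: (conv2_col (X0 := X0)) => //; exact: le_lt_trans XX0.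
Qed.

Lemma conv2_geometric X0 S0 a x s : conv2 X0 S0 a -> `|x| < X0 -> `|s| < S0 ->
  exists C q r, [/\ 0 <= q < 1, 0 <= r < 1 &
    forall p l, `|a p l * s ^+ l * x ^+ p| <= C * q ^+ p * r ^+ l].
Proof.
move=> ca xX0 sS0; have s0 := normr_ge0 s; have x0 := normr_ge0 x.
have [S sS Sb] : exists2 S, `|s| < S & 0 <= S < S0.
  by exists ((`|s| + S0) / 2); lra.
have [X xX Xb] : exists2 X, `|x| < X & 0 <= X < X0.
  by exists ((`|x| + X0) / 2); lra.
have [C aC] := ca _ _ Xb Sb.
have S00 : 0 < S by lra.
have X00 : 0 < X by lra.
exists C, (`|x| / X), (`|s| / S); split.
- by rewrite divr_ge0 ?(ltW X00) //= ltr_pdivrMr // mul1r.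
- by rewrite divr_ge0 ?(ltW S00) //= ltr_pdivrMr // mul1r.
move=> p l; rewrite !normrM !normrX !expr_div_n.
rewrite [leRHS](_ : _ = C * (`|x| ^+ p * `|s| ^+ l) / (X ^+ p * S ^+ l));
  last first.
  have Xp : X ^+ p != 0 by rewrite expf_neq0 ?lt0r_neq0.
  have Sl : S ^+ l != 0 by rewrite expf_neq0 ?lt0r_neq0.
  by field; rewrite ?Xp ?Sl.
rewrite ler_pdivlMr ?mulr_gt0 ?exprn_gt0 //.
have := aC p l; rewrite normrM normrX (gtr0_norm X00) => aCpl.
rewrite [leLHS](_ : _ = `|a p l| * X ^+ p * S ^+ l * (`|x| ^+ p * `|s| ^+ l)).
  by rewrite ler_wpM2r ?mulr_ge0 ?exprn_ge0.
by ring.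
Qed.

Lemma psum2E X0 S0 a x s : conv2 X0 S0 a -> `|x| < X0 -> `|s| < S0 ->
  psum2 a x s =
  limn (series (fun p => limn (series (fun l => a p l * s ^+ l * x ^+ p)))).
Proof.
move=> ca xX sS; have X0p : 0 < X0 by exact: le_lt_trans xX.
congr (limn (series _)); apply/funext => p /=; rewrite mulrC.
rewrite -(psumZ _ (conv2_col p X0p ca) sS).
by congr (limn (series _)); apply/funext => l /=; ring.
Qed.

Lemma psum2_swap X0 S0 a x s : conv2 X0 S0 a -> `|x| < X0 -> `|s| < S0 ->
  psum2 a x s = psum2 (fun l p => a p l) s x.
Proof.
move=> ca xX sS; have [C [q [r [q01 r01 aC]]]] := conv2_geometric ca xX sS.
rewrite (psum2E ca xX sS) (psum2E (conv2_swap ca) sS xX).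
rewrite (double_series_exchange q01 r01 aC).
congr (limn (series _)); apply/funext => l.
by congr (limn (series _)); apply/funext => p; rewrite mulrAC.
Qed.

Lemma psum2D X0 S0 a b x s : 0 < X0 -> conv2 X0 S0 a -> conv2 X0 S0 b ->
  `|x| < X0 -> `|s| < S0 ->
  psum2 (fun p l => a p l + b p l) x s = psum2 a x s + psum2 b x s.
Proof.
move=> X00 ca cb xX sS.
rewrite /psum2 -(psumD (conv2_row ca sS) (conv2_row cb sS) xX).
congr psum; apply/funext => p.
exact: (psumD (conv2_col p X00 ca) (conv2_col p X00 cb) sS).
Qed.

Lemma psum2Z X0 S0 a c x s : 0 < X0 -> conv2 X0 S0 a ->
  `|x| < X0 -> `|s| < S0 ->
  psum2 (fun p l => c * a p l) x s = c * psum2 a x s.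
Proof.
move=> X00 ca xX sS; rewrite /psum2 -(psumZ c (conv2_row ca sS) xX).
by congr psum; apply/funext => p; exact: (psumZ c (conv2_col p X00 ca) sS).
Qed.

Lemma is_derive_psum2_x X0 S0 a x s : 0 < X0 -> conv2 X0 S0 a ->
  `|x| < X0 -> `|s| < S0 ->
  is_derive x (1 : R) (psum2 a ^~ s) (psum2 (diff0 a) x s).
Proof.
move=> X00 ca xX sS; have := is_derive_psum (conv2_row ca sS) xX.
rewrite [X in is_derive _ _ _ (psum X _)](_ : _ =
  (fun p => psum (diff0 a p) s)) //.
apply/funext => p; rewrite /pseries_diffs -(psumZ _ (conv2_col _ X00 ca) sS).
by congr psum.
Qed.

Lemma is_derive_psum2_s X0 S0 a x s : 0 < X0 -> 0 < S0 -> conv2 X0 S0 a ->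
  `|x| < X0 -> `|s| < S0 ->
  is_derive s (1 : R) (psum2 a x) (psum2 (diffs a) x s).
Proof.
(* The variable s sits in the inner sum, where differentiation would need uniformity in the outer
   index. Swapping the sums makes it the outer one; the swap is valid only for |t| < S0, hence near
   s. *)
move=> X00 S00 ca xX sS; rewrite (psum2_swap (conv2_diffs ca) xX sS).
apply: (@near_eq_is_derive _ _ _ (psum2 (fun l p => a p l) ^~ x)).
  have : \forall t \near s, `|t| < S0.
    have : id t @[t --> s] --> s by exact: cvg_id.
    by move/cvgr_norm_lt; exact.
  by apply: filterS => t tS; rewrite (psum2_swap ca xX tS).
exact: is_derive_psum2_x (conv2_swap ca) sS xX.
Qed.

Lemma psum2_weight X0 S0 a x s : 0 < X0 -> conv2 X0 S0 a ->
  `|x| < X0 -> `|s| < S0 ->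
  psum2 (fun p l => l%:R * a p l) x s = s * psum2 (diffs a) x s.
Proof.
move=> X00 ca xX sS.
rewrite /psum2 -(psumZ _ (conv2_row (conv2_diffs ca) sS) xX); congr psum.
by apply/funext => p; rewrite (psum_weight (conv2_col p X00 ca) sS).
Qed.

End DoublePowerSeries.

(** * The Vekua system on coefficients *)

Section CoefficientIdentities.
Variable R : realType.
Implicit Types (a b : nat -> nat -> R) (f g : nat -> R) (N M : nat) (c : nat ->
  R).

(* Coefficient form of the Cauchy-Riemann type (Vekua) system
   [d_x a = 2 s d_s b + (2 M + 1) b], [d_x b = - 2 d_s a] with [s = |x|^2];
   [M = 0] is holomorphy of [a + i r b], [M = N] is monogenicity of
   [(a + b x) P]. *)
Definition vekua M a b :=
  (forall p l, diff0 a p l = (2 * l + 2 * M + 1)%:R * b p l) /\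
  (forall p l, diff0 b p l = - 2 * diffs a p l).

(** The operator d_0^2 + 4 s d_s^2 + w d_s. With w = 2 m + 4 d it is the Laplacian acting on the
    radial factor of a harmonic homogeneous polynomial of degree d. *)
Definition flap w a p l : R :=
  diff0 (diff0 a) p l + (4 * l + w)%:R * diffs a p l.

(** The commutator of d_s with 2 s d_s is 2 d_s, which raises the constant 2 M + 1 by 2. *)
Lemma vekua_diffs M a b : vekua M a b -> vekua M.+1 (diffs a) (diffs b).
Proof.
move=> [ab ba]; split => p l.
  have := ab p l.+1; rewrite /diff0 /diffs => H.
  by rewrite mulrCA H [RHS]mulrCA; congr (_ * (_%:R * _)); lia.
by have := ba p l.+1; rewrite /diff0 /diffs => H; rewrite mulrCA H; ring.
Qed.

Lemma vekuaZ M a b k : vekua M a b ->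
  vekua M (fun p l => k * a p l) (fun p l => k * b p l).
Proof.
move=> [ab ba]; split => p l.
  by have := ab p l; rewrite /diff0 => H; rewrite mulrCA H mulrCA.
by have := ba p l; rewrite /diff0 /diffs => H; rewrite mulrCA H; ring.
Qed.

(** Eliminating the other unknown gives d_0^2 a = -(4 s d_s + 4 M + 2) d_s a and d_0^2 b = -(4 s d_s
    + 4 M + 6) d_s b. The second-order terms of [flap] cancel, leaving the difference of the
    first-order constants. *)
Lemma flap_vekua M N a b p l : (M <= N)%N -> vekua M a b ->
  flap (4 * N + 2) a p l = (4 * (N - M))%:R * diffs a p l /\
  flap (4 * N + 6) b p l = (4 * (N - M))%:R * diffs b p l.
Proof.
move=> MN [ab ba]; split; rewrite /flap.
  have -> : diff0 (diff0 a) p l = - (2 * (2 * l + 2 * M + 1))%:R * diffs a p l.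
    rewrite {1}/diff0 ab mulrCA -[_ * b _ _]/(diff0 b p l) ba natrM.
    by ring.
  rewrite -mulrDl; congr (_ * _).
  by rewrite addrC -natrB; [congr (_%:R); lia|lia].
have -> : diff0 (diff0 b) p l = - (2 * (2 * l + 2 * M + 3))%:R * diffs b p l.
  rewrite {1}/diff0 ba mulrCA {1}/diffs.
  have := ab p l.+1; rewrite /diff0 => H.
  rewrite [p.+1%:R * _]mulrCA H /diffs.
  have -> : (2 * l.+1 + 2 * M + 1 = 2 * l + 2 * M + 3)%N by lia.
  by rewrite natrM; ring.
rewrite -mulrDl; congr (_ * _).
by rewrite addrC -natrB; [congr (_%:R); lia|lia].
Qed.

(** The Dirac operator on f P + g x P, read on the coefficients of f and g in s: (f, g) goes to (-(2
    s g' + (2 N + 1) g), 2 f'). *)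
Definition fdirac N (fg : (nat -> R) * (nat -> R)) : (nat -> R) * (nat -> R) :=
  (fun l => - ((2 * l + 2 * N + 1)%:R * fg.2 l), fun l =>
    2 * (l.+1%:R * fg.1 l.+1)).

(** The system with M = N says d_0 (a, b) = - [fdirac] (a, b); solving it in powers of x_0 produces
    the exponential series that defines [CK]. *)
Lemma vekua_iter_fdirac N a b p l : vekua N a b ->
  a p l = (-1) ^+ p / (p`!)%:R * (iter p (fdirac N) (a 0%N, b 0%N)).1 l /\
  b p l = (-1) ^+ p / (p`!)%:R * (iter p (fdirac N) (a 0%N, b 0%N)).2 l.
Proof.
move=> [ab ba]; elim: p l => [|p IH] l.
  by rewrite expr0 fact0 divr1 !mul1r.
have p0 : p.+1%:R != 0 :> R by rewrite pnatr_eq0.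
have f0 : (p`!)%:R != 0 :> R by rewrite pnatr_eq0 -lt0n fact_gt0.
rewrite factS natrM exprS /=; split; apply: (mulfI p0).
  rewrite -[LHS]/(diff0 a p l) ab (IH l).2; field.
  by rewrite f0 nat1r p0.
rewrite -[LHS]/(diff0 b p l) ba /diffs (IH l.+1).1; field.
by rewrite f0 nat1r p0.
Qed.

Lemma iter_fdiracZ N f k p l :
  (iter p (fdirac N) (fun l => k * f l, fun=> 0)).1 l =
    k * (iter p (fdirac N) (f, fun=> 0)).1 l /\
  (iter p (fdirac N) (fun l => k * f l, fun=> 0)).2 l =
    k * (iter p (fdirac N) (f, fun=> 0)).2 l.
Proof.
elim: p l => [|p IH] l /=; first by rewrite mulr0.
by rewrite (IH l).2 (IH l.+1).1; split; ring.
Qed.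

Lemma iter_diffs N a p l :
  iter N (@diffs R) a p l = (l + N)`!%:R / l`!%:R * a p (l + N)%N.
Proof.
have f0 n : (n`!)%:R != 0 :> R by rewrite pnatr_eq0 -lt0n fact_gt0.
elim: N l => [|N IH] l; first by rewrite addn0 divff ?mul1r.
rewrite iterS /diffs IH addSnnS [l.+1`!]factS natrM; field.
by rewrite f0 nat1r pnatr_eq0.
Qed.

(* Coefficients of the real part, and of the imaginary part divided by [y],
   of [\sum_n c_n (x + i y)^n] in powers of [x] and [s = y ^ 2]. *)
Definition re_coef c p l : R := c (p + 2 * l)%N * (-1) ^+ l * 'C(p +
  2 * l, 2 * l)%:R.
Definition im_coef c p l : R :=
  c (p + 2 * l).+1 * (-1) ^+ l * 'C((p + 2 * l).+1, (2 * l).+1)%:R.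

(** The Cauchy-Riemann equations for each power of z; both amount to (k + 1) C(n, k + 1) = (n - k)
    C(n, k). *)
Lemma vekua_coef c : vekua 0 (re_coef c) (im_coef c).
Proof.
split => p l; rewrite /diff0 /diffs /re_coef /im_coef.
  rewrite !addSn muln0 addn0 addn1 mulrCA [RHS]mulrCA -!natrM; congr (_ * _%:R).
  by have := mul_bin_left (p + 2 * l).+1 (2 * l);
    rewrite subSn ?leq_addl // addnK.
have -> : (p.+1 + 2 * l).+1 = (p + 2 * l.+1)%N by lia.
rewrite exprS.
have := mul_bin_left (p + 2 * l.+1) (2 * l).+1.
have -> : (p + 2 * l.+1 - (2 * l).+1 = p.+1)%N by lia.
have -> : ((2 * l).+2 = 2 * l.+1)%N by lia.
move/(congr1 (fun n => n%:R : R)); rewrite !natrM => H.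
rewrite mulrCA -H; ring.
Qed.

End CoefficientIdentities.

(** * The binomial series *)

Section BinomialSeries.
Local Open Scope classical_set_scope.
Variable R : realType.
Implicit Types (c : nat -> R) (gamma alpha x y s w : R).

Lemma cpow_expand x y n :
  (cpow x y n).1 =
    \sum_(0 <= l < n.+1) (-1) ^+ l * 'C(n, 2 * l)%:R * x ^+ (n - 2 * l) *
      (y ^+ 2) ^+ l /\
  (cpow x y n).2 =
    y * \sum_(0 <= l < n.+1)
      (-1) ^+ l * 'C(n, (2 * l).+1)%:R * x ^+ (n - (2 * l).+1) * (y ^+ 2) ^+ l.
Proof.
(* Exponents use truncated subtraction; wherever it truncates, the binomial coefficient vanishes. *)
have xC k i : 'C(k, i)%:R * (x * x ^+ (k - i)) = 'C(k, i)%:R * x ^+ (k.+1 - i).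
  case: (leqP i k) => ik; first by rewrite subSn // exprS.
  by rewrite bin_small // !mul0r.
elim: n => [|n [IH1 IH2]].
  split; first by rewrite big_nat1 bin0 !expr0 !mulr1.
  by rewrite big_nat1 bin_small // mulr0 !mul0r mulr0.
rewrite /cpow iterS -/(cpow x y n) /= IH1 IH2; split.
  rewrite [in RHS]big_nat_recl //= !muln0 bin0 subn0 !expr0 !mulr1 mul1r.
  have E : \sum_(0 <= l < n.+1) (-1) ^+ l * 'C(n, 2 * l)%:R * x ^+ (n.+1 - 2 *
    l) * (y ^+ 2) ^+ l =
    x ^+ n.+1 + \sum_(0 <= l < n.+1) (-1) ^+ l.+1 * 'C(n, 2 * l.+1)%:R *
      x ^+ (n.+1 - 2 * l.+1) * (y ^+ 2) ^+ l.+1.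
    transitivity (\sum_(0 <= l < n.+2) (-1) ^+ l * 'C(n, 2 * l)%:R *
      x ^+ (n.+1 - 2 * l) * (y ^+ 2) ^+ l).
      rewrite [RHS]big_nat_recr //= [X in _ + X](_ : _ = 0) ?addr0 //.
      by rewrite bin_small ?mulr0 ?mul0r //; lia.
    by rewrite big_nat_recl //= !muln0 bin0 subn0 !expr0 !mulr1 mul1r.
  rewrite mulr_sumr (eq_bigr (fun l => (-1) ^+ l * 'C(n, 2 * l)%:R *
    x ^+ (n.+1 - 2 * l) * (y ^+ 2) ^+ l)).
    rewrite E -addrA; congr (_ + _); rewrite mulrA mulr_sumr -sumrB.
    apply: eq_bigr => l _.
    have -> : (2 * l.+1 = (2 * l).+2)%N by lia.
    by rewrite binS natrD subSS !exprS; ring.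
  move=> l _; transitivity ((-1) ^+ l * ('C(n, 2 * l)%:R * (x * x ^+ (n - 2 *
    l))) * (y ^+ 2) ^+ l).
    by ring.
  by rewrite xC; ring.
rewrite [in RHS]big_nat_recr //= [X in _ * (_ + X)](_ : _ = 0) ?addr0;
  last first.
  by rewrite bin_small ?mulr0 ?mul0r //; lia.
rewrite mulrCA -mulrDr; congr (_ * _); rewrite mulr_sumr -big_split.
apply: eq_bigr => l _ /=; rewrite binS natrD subSS.
transitivity ((-1) ^+ l * ('C(n, (2 * l).+1)%:R * (x * x ^+ (n - (2 * l).+1))) *
  (y ^+ 2) ^+ l +
  (-1) ^+ l * 'C(n, 2 * l)%:R * x ^+ (n - 2 * l) * (y ^+ 2) ^+ l);
    first by ring.
by rewrite xC subSS; ring.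
Qed.

Lemma cpow_norm x y n :
  `|(cpow x y n).1| + `|(cpow x y n).2| <= (`|x| + `|y|) ^+ n.
Proof.
elim: n => [|n IH]; first by rewrite /= normr1 normr0 addr0.
rewrite exprS; apply: le_trans (ler_wpM2l _ IH); last by rewrite addr_ge0.
rewrite /cpow iterS -/(cpow x y n) /=.
apply: le_trans (lerD (ler_normB _ _) (ler_normD _ _)) _.
by rewrite !normrM; lra.
Qed.

Lemma gbinomS gamma n : n.+1%:R * gbinom gamma n.+1 =
  (gamma - n%:R) * gbinom gamma n.
Proof.
rewrite /gbinom big_ord_recr /= factS natrM.
have f0 : (n`!)%:R != 0 :> R by rewrite pnatr_eq0 -lt0n fact_gt0.
by field; rewrite f0 nat1r pnatr_eq0.
Qed.

(** With an integer M >= |gamma|, the product of the |gamma - i| is at most (n + M)!. The resulting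
    majorant (n + M)! / n! is the coefficient sequence of the M-th derivative of the geometric
    series, so [conv1_diffs] applies. *)
Lemma conv1_gbinom gamma : conv1 1 (gbinom gamma).
Proof.
pose M := (Num.truncn `|gamma|).+1.
have gM : `|gamma| <= M%:R by rewrite /M ltW // truncnS_gt.
have f0 n : 0 < (n`!)%:R :> R by rewrite ltr0n fact_gt0.
pose D := iter M (@pseries_diffs R) (fun=> 1).
have DE n : D n = (n + M)`!%:R / n`!%:R.
  rewrite /D; elim: (M) n => [|k IH] n; first by rewrite addn0 divff ?lt0r_neq0.
  rewrite iterS {1}/pseries_diffs IH addSnnS [n.+1`!]factS natrM; field.
  by rewrite (lt0r_neq0 (f0 n)) nat1r pnatr_eq0.
have cD : conv1 1 D.
  rewrite /D; elim: (M) => [|k IH]; last by rewrite iterS; exact: conv1_diffs.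
  move=> S /andP[S0 S1]; exists 1 => _ n /=.
  by rewrite normr1 mul1r exprn_ile1 // ltW.
move=> S Sb; have /andP[S0 _] := Sb; apply: cauchy_bounded_le S0 _ (cD S Sb).
move=> _ n; rewrite DE /gbinom !normrM ler_wpM2r //.
rewrite normr_prod [leRHS]ger0_norm ?ler0n //.
elim: n => [|n IH]; first by rewrite big_ord0 ler1n fact_gt0.
rewrite big_ord_recr /= addSn factS mulnC natrM ler_pM ?prodr_ge0 //.
rewrite (le_trans (ler_normB _ _)) // [`|n%:R|]ger0_norm // addrC.
by rewrite -addn1 !natrD; lra.
Qed.

Definition even_coef c n : R := if odd n then 0 else c n./2.

Lemma conv1_even_coef c : conv1 1 c -> conv1 1 (even_coef c).
Proof.
move=> cc S /andP[S0 S1].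
have Sb : 0 <= S ^+ 2 < 1 by rewrite exprn_ge0 // expr_lt1.
have [C cC] := cc _ Sb; have C0 := cauchy_bounded_ge0 tt cC.
exists C => _ n; rewrite /even_coef; case: ifPn => on;
  first by rewrite normr0 mul0r.
rewrite -[n in S ^+ n]odd_double_half (negbTE on) add0n -mul2n exprM.
exact: (cC tt).
Qed.

Lemma lim_even_series (u : nat -> R) : (forall n, odd n -> u n = 0) ->
  cvgn (series u) -> limn (series (fun n => u (2 * n)%N)) = limn (series u).
Proof.
move=> u0 cu; apply: cvg_lim => //.
have -> : series (fun n => u (2 * n)%N) = series u \o (fun n => 2 * n)%N.
  apply/funext => n; rewrite /series /=; elim: n => [|n IH].
    by rewrite !big_geq.
  rewrite big_nat_recr //= IH mulnS !addSn add0n !big_nat_recr //=.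
  by rewrite [u _.+1]u0 ?addr0 // mul2n /= odd_double.
apply: cvg_comp cu.
by apply/cvgnyPge => A; exists A => // n /= An;
  rewrite (leq_trans An) // leq_pmull.
Qed.

(** C(p + 2 l, 2 l) X^p S^l is one term of the expansion of (X + sqrt S)^(p + 2 l), whose terms are
    all nonnegative. The shape of the polydisc comes from here. *)
Lemma conv2_re_coef c X0 S0 : 0 <= S0 -> X0 + Num.sqrt S0 <= 1 -> conv1 1 c ->
  conv2 X0 S0 (re_coef c).
Proof.
move=> S00 XS cc X S /andP[X00 XX0] /andP[SS SS0].
have qS : Num.sqrt S < Num.sqrt S0 by rewrite ltr_sqrt // (le_lt_trans SS).
have q0 := sqrtr_ge0 S.
have rb : 0 <= X + Num.sqrt S < 1 by lra.
have [C cC] := cc _ rb; exists C => p l; apply: le_trans (cC tt (p + 2 * l)%N).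
rewrite /re_coef !normrM normrX normrN1 expr1n mulr1 -!mulrA ler_wpM2l //.
rewrite !ger0_norm ?exprn_ge0 ?ler0n //.
have -> : S ^+ l = Num.sqrt S ^+ (2 * l) by rewrite exprM sqr_sqrtr.
rewrite exprDn (bigD1 (inord (2 * l) : 'I_(p + 2 * l).+1)) //=.
rewrite inordK ?ltnS ?leq_addl // addnK mulr_natl lerDl.
by apply: sumr_ge0 => i _; rewrite mulrn_wge0 // mulr_ge0 ?exprn_ge0.
Qed.

(** By the first Cauchy-Riemann equation these coefficients are those of d_0 of the real part
    divided by 2 l + 1. *)
Lemma conv2_im_coef c X0 S0 : 0 <= S0 -> X0 + Num.sqrt S0 <= 1 -> conv1 1 c ->
  conv2 X0 S0 (im_coef c).
Proof.
move=> S00 XS /(conv2_re_coef S00 XS)/conv2_diff0; apply: conv2_le => p l.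
rewrite (vekua_coef c).1 [leRHS]normrM ler_peMl // ger0_norm ?ler0n //.
by rewrite ler1n addn1.
Qed.

Lemma cpow_series_cvg c x y : conv1 1 c -> `|x| + `|y| < 1 ->
  cvgn (series (fun n => c n * (cpow x y n).1)) /\
  cvgn (series (fun n => c n * (cpow x y n).2)).
Proof.
move=> cc xy1; have x0 := normr_ge0 x; have y0 := normr_ge0 y.
have [S xyS Sb] : exists2 S, `| `|x| + `|y| | < S & 0 <= S < 1.
  by rewrite ger0_norm ?addr_ge0 //; exists ((`|x| + `|y| + 1) / 2); lra.
have [C q01 cC] := cauchy_bounded_geometric xyS (cc S Sb).
have xyn n : 0 <= (`|x| + `|y|) ^+ n by rewrite exprn_ge0 // addr_ge0.
by split; apply: (geometric_cvg q01) => n; apply: le_trans (cC tt n);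
  rewrite !normrM ler_wpM2l // [leRHS]ger0_norm //;
  apply: le_trans (cpow_norm x y n); rewrite ?lerDl ?lerDr.
Qed.

Lemma cpow_series_re c X0 S0 x y : 0 <= S0 -> X0 + Num.sqrt S0 <= 1 ->
  conv1 1 c ->
  `|x| < X0 -> `|y ^+ 2| < S0 ->
  limn (series (fun n => c n * (cpow x y n).1)) = psum2 (re_coef c) x (y ^+ 2).
Proof.
move=> S00 XS cc xX yS; have cr := conv2_re_coef S00 XS cc.
have [C [q [r [q01 r01 aC]]]] := conv2_geometric cr xX yS.
rewrite (psum2E cr xX yS) -(diagonal_series 0 q01 r01 aC).
congr (limn (series _)); apply/funext => n; rewrite (cpow_expand x y n).1.
rewrite mulr_sumr [RHS]big_mkcond; apply: eq_bigr => l _; rewrite addn0.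
case: leqP => ln; first by rewrite /re_coef subnK //; ring.
by rewrite bin_small // mulr0 !mul0r mulr0.
Qed.

Lemma cpow_series_im c X0 S0 x y : 0 <= S0 -> X0 + Num.sqrt S0 <= 1 ->
  conv1 1 c ->
  `|x| < X0 -> `|y ^+ 2| < S0 -> 
  limn (series (fun n => c n * (cpow x y n).2)) =
    y * psum2 (im_coef c) x (y ^+ 2).
Proof.
move=> S00 XS cc xX yS; have cr := conv2_im_coef S00 XS cc.
have [C [q [r [q01 r01 aC]]]] := conv2_geometric cr xX yS.
rewrite (psum2E cr xX yS) -(diagonal_series 1 q01 r01 aC).
set u := (X in series X); set v := (X in y * limn (series X)).
have E : u = y *: v.
  apply/funext => n; rewrite /u /v (cpow_expand x y n).2 mulrCA; congr (_ * _).
  rewrite mulr_sumr [RHS]big_mkcond; apply: eq_bigr => l _; rewrite addn1.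
  case: leqP => ln; first by rewrite bin_small // mulr0 !mul0r mulr0.
  have nE : ((n - (2 * l).+1 + 2 * l).+1 = n)%N by lia.
  by rewrite /im_coef nE; ring.
(* Convergence of [v] is recovered from that of [u] by dividing by y, so y = 0 stands apart. *)
case: (eqVneq y 0) => [y0|y0].
  by rewrite E y0 scale0r mul0r; apply: cvg_lim => //; rewrite /series /=;
    under eq_fun do rewrite big1 //; exact: cvg_cst.
have cu : cvgn (series u).
  apply: (cpow_series_cvg cc _).2.
  have : `|y| < Num.sqrt S0.
    rewrite -sqrtr_sqr ltr_sqrt ?(le_lt_trans (ler_norm _) yS) //.
    exact: le_lt_trans yS.
  lra.
rewrite -[RHS]/(y *: _) E lim_seriesZ //.
have -> : v = y^-1 *: u by rewrite E scalerA mulVf // scale1r.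
exact: is_cvg_seriesZ.
Qed.

Lemma binom_re_psum2 gamma X0 S0 x y : 0 <= S0 -> X0 + Num.sqrt S0 <= 1 ->
  `|x| < X0 -> `|y ^+ 2| < S0 ->
  binom_re gamma x y = psum2 (re_coef (even_coef (gbinom gamma))) x (y ^+ 2) /\
  binom_im gamma x y = y * psum2 (im_coef (even_coef (gbinom gamma))) x (y ^+
    2).
Proof.
move=> S00 XS xX yS.
have cc := conv1_even_coef (conv1_gbinom gamma).
have xy : `|x| + `|y| < 1.
  have : `|y| < Num.sqrt S0.
    rewrite -sqrtr_sqr ltr_sqrt ?(le_lt_trans (ler_norm _) yS) //.
    exact: le_lt_trans yS.
  lra.
have [c1 c2] := cpow_series_cvg cc xy.
rewrite -(cpow_series_re S00 XS cc xX yS) -(cpow_series_im S00 XS cc xX yS).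
rewrite -(lim_even_series _ c1) => [|n on]; last by rewrite /even_coef on mul0r.
rewrite -(lim_even_series _ c2) => [|n on]; last by rewrite /even_coef on mul0r.
by rewrite /binom_re /binom_im; split; congr (limn (series _));
  apply/funext => n; rewrite /even_coef mul2n odd_double doubleK.
Qed.

Lemma gbinom_series_ode alpha w : `|w| < 1 ->
  (1 + w) * psum (pseries_diffs (gbinom alpha)) w =
    alpha * psum (gbinom alpha) w.
Proof.
move=> w1; have cg := conv1_gbinom alpha; have cd := conv1_diffs cg.
rewrite mulrDl mul1r -(psum_weight cg w1) -(psumZ alpha cg w1).
rewrite -(psumD cd (conv1_weight cg) w1); congr psum; apply/funext => n.
by rewrite /pseries_diffs gbinomS; ring.
Qed.

(** By the differential equation, [H], the series times (1 + t)^(-alpha), has derivative 0, so it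
    keeps its value 1 at 0. The range of w is that of -s with 0 <= s < 1. *)
Lemma gbinom_series alpha w : -1 < w <= 0 ->
  psum (gbinom alpha) w = (1 + w) `^ alpha.
Proof.
move=> /andP[w1 w0].
pose H t := psum (gbinom alpha) t * (1 + t) `^ (- alpha).
have dH t : `|t| < 1 -> is_derive t (1 : R) H 0.
  rewrite ltr_norml => /andP[t1 t2].
  have tt1 : `|t| < 1 by rewrite ltr_norml t1.
  have p1 : 0 < 1 + t by lra.
  have d1 := is_derive_psum (conv1_gbinom alpha) tt1.
  have d2 : is_derive t (1 : R) (fun t => (1 + t) `^ (- alpha))
      (- alpha * (1 + t) `^ (- alpha - 1)).
    have d1t : is_derive t (1 : R) (fun t => 1 + t) 1.
      apply: is_derive_eq (is_deriveD (is_derive_cst (1 : R) t 1) (is_derive_id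
        t 1)) _.
      by rewrite add0r.
    have dp := is_derive1_powR (- alpha) p1.
    by apply: is_derive_eq (is_derive1_comp dp d1t) _; rewrite mulr1.
  apply: is_derive_eq (is_deriveM d1 d2) _.
  have -> : (1 + t) `^ (- alpha) = (1 + t) `^ (- alpha - 1) * (1 + t).
    by rewrite -[X in _ * X]powRr1 ?(ltW p1) // -powRD ?subrK // (gt_eqF p1)
      implybT.
  transitivity ((1 + t) `^ (- alpha - 1) * ((1 + t) *
     psum (pseries_diffs (gbinom alpha)) t - alpha * psum (gbinom alpha) t)).
    by rewrite /GRing.scale /=; ring.
  by rewrite gbinom_series_ode // subrr mulr0.
have Hw : H w = H 0.
  have cH : {within `[w, 0], continuous H}.
    apply: derivable_within_continuous => t; rewrite in_itv /= => /andP[wt t0].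
    by have [] : is_derive t (1 : R) H 0 by apply: dH; rewrite ltr_norml; lra.
  have d0 t : t \in `]w, 0[%R -> is_derive t (1 : R) H 0.
    by rewrite in_itv /= => /andP[wt t0]; apply: dH; rewrite ltr_norml; lra.
  have [t _] := MVT_segment w0 d0 cH.
  by rewrite mul0r => /eqP; rewrite subr_eq0 => /eqP.
have H0 : H 0 = 1.
  rewrite /H addr0 powR1 mulr1 /psum; apply: cvg_lim => //.
  apply: cvg_near_cst; exists 1%N => // n /= n0.
  rewrite /pseries /series /= (big_cat_nat _ (n := 1)) //= big_nat1 expr0 mulr1.
  rewrite [X in _ + X]big1_seq ?addr0; first by rewrite /gbinom big_ord0 fact0
    divr1.
  move=> i /=; rewrite mem_index_iota => /andP[i0 _].
  by rewrite expr0n gtn_eqF // mulr0.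
have p1 : 0 < (1 + w) `^ alpha by rewrite powR_gt0 //; lra.
move: Hw; rewrite H0 /H powRN => /(canRL (mulfVK _)).
by rewrite mul1r => -> //; rewrite lt0r_neq0.
Qed.

End BinomialSeries.

(** * Spherical monogenics *)

Section PartialDerivatives.
Local Open Scope classical_set_scope.
Variables (R : realType) (m : nat).
Implicit Types (x y : 'I_m -> R) (g h : ('I_m -> R) -> R) (i j : 'I_m).

(** A relation, so that derivability travels with the value; [pdx] alone records only the value. *)
Definition is_pd j g x (d : R) :=
  is_derive (x j) (1 : R) (fun t => g (upd x j t)) d.

Lemma upd_id x j : upd x j (x j) = x.
Proof. by apply/funext => i; rewrite /upd; case: eqP => [->|]. Qed.

Lemma upd_same x j t : upd x j t j = t.
Proof. by rewrite /upd eqxx. Qed.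

Lemma is_pd_eq j g x d d' : is_pd j g x d -> d = d' -> is_pd j g x d'.
Proof. by move=> gd <-. Qed.

Lemma is_pd_unique j g x d d' : is_pd j g x d -> is_pd j g x d' -> d = d'.
Proof. by move=> [_ <-] [_ <-]. Qed.

Lemma is_pd_cst j (c : R) x : is_pd j (fun=> c) x 0.
Proof. exact: is_derive_cst. Qed.

Lemma is_pdD j g h x d e : is_pd j g x d -> is_pd j h x e ->
  is_pd j (fun y => g y + h y) x (d + e).
Proof. exact: is_deriveD. Qed.

Lemma is_pdM j g h x d e : is_pd j g x d -> is_pd j h x e ->
  is_pd j (fun y => g y * h y) x (d * h x + g x * e).
Proof.
move=> gd he; apply: is_pd_eq (is_deriveM gd he) _.
by rewrite upd_id /GRing.scale /=; ring.
Qed.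

Lemma is_pdZ j g x d (c : R) : is_pd j g x d ->
  is_pd j (fun y => c * g y) x (c * d).
Proof.
by move=> gd; apply: is_pd_eq (is_pdM (is_pd_cst j c x) gd) _;
  rewrite mul0r add0r.
Qed.

Lemma is_pd_sum j (I : Type) (r : seq I) (g : I -> ('I_m -> R) -> R) x (d : I ->
  R) :
  (forall q, is_pd j (g q) x (d q)) ->
  is_pd j (fun y => \sum_(q <- r) g q y) x (\sum_(q <- r) d q).
Proof.
move=> gd; elim: r => [|q r IH].
  rewrite big_nil (_ : (fun _ => _) = (fun=> 0)); first exact: is_pd_cst.
  by apply/funext => y; rewrite big_nil.
rewrite big_cons (_ : (fun _ => _) = (fun y => g q y + \sum_(q <- r) g q y)).
  exact: is_pdD.
by apply/funext => y; rewrite big_cons.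
Qed.

Lemma is_pd_coord i j x : is_pd j (fun y => y i) x (i == j)%:R.
Proof.
rewrite /is_pd /upd; case: eqP => _; first exact: is_derive_id.
exact: is_derive_cst.
Qed.

(** The radial formulas hold only on a ball, so [g] is exchanged for [h] near the point alone. *)
Lemma derive1_pd j g h x d : is_pd j h x d ->
  (\forall t \near x j, g (upd x j t) = h (upd x j t)) ->
  derive1 (fun t => g (upd x j t)) (x j) = d.
Proof.
move=> hd gh; rewrite derive1E.
by have [_ ->] : is_derive (x j) (1 : R) (fun t => g (upd x j t)) d
  by apply: near_eq_is_derive hd; apply: filterS gh => t ->.
Qed.

Definition sqnorm x : R := \sum_j x j ^+ 2.

Lemma sqnorm_ge0 x : 0 <= sqnorm x.
Proof. by apply: sumr_ge0 => i _; rewrite sqr_ge0. Qed.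

Lemma is_pd_sqnorm j x : is_pd j sqnorm x (2 * x j).
Proof.
apply: is_pd_eq (is_pd_sum _ (fun i => is_pdM (is_pd_coord i j x) (is_pd_coord i
  j x))) _.
rewrite (bigD1 j) //= eqxx big1 ?addr0 /=; first by rewrite mulr1n; ring.
by move=> i /negbTE ->; rewrite mul0r mulr0 addr0.
Qed.

Lemma near_sqnorm_lt j x (S0 : R) : sqnorm x < S0 ->
  \forall t \near x j, sqnorm (upd x j t) < S0.
Proof.
move=> xS; have [d _] := is_pd_sqnorm j x.
have /differentiable_continuous : differentiable (fun t =>
  sqnorm (upd x j t)) (x j).
  exact/derivable1_diffP.
move=> /cvgr_lt; apply; by rewrite upd_id.
Qed.

Lemma is_pd_radial j (phi : R -> R) x d : is_derive (sqnorm x) (1 : R) phi d ->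
  is_pd j (fun y => phi (sqnorm y)) x (d * (2 * x j)).
Proof.
move=> pd; have sd := is_pd_sqnorm j x; rewrite -[x in is_derive (sqnorm
  x)](upd_id x j) in pd.
exact: (is_derive1_comp pd sd).
Qed.

Definition monomial (e : 'I_m -> nat) x : R := \prod_j x j ^+ e j.

(** At exponent 0 the predecessor stays 0; the factor [(e j)%:R] in front of each use then
    vanishes. *)
Definition decr j (e : 'I_m -> nat) i := if i == j then (e i).-1 else e i.

Lemma is_pd_monomial j e x : is_pd j (monomial e) x ((e j)%:R *
  monomial (decr j e) x).
Proof.
pose c := \prod_(i < m | i != j) x i ^+ e i.
have E t : monomial e (upd x j t) = c * t ^+ e j.
  rewrite /monomial (bigD1 j) //= upd_same mulrC; congr (_ * _).
  by apply: eq_bigr => i /negbTE ij; rewrite /upd ij.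
rewrite /is_pd (_ : (fun _ => _) = (fun t => c * t ^+ e j)); last exact/funext.
have -> : (e j)%:R * monomial (decr j e) x = c * ((e j)%:R * x j ^+ (e j).-1).
  rewrite /monomial (bigD1 j) //= /decr eqxx mulrCA [RHS]mulrC mulrA;
    congr (_ * _).
    by rewrite mulrC.
  by apply: eq_bigr => i /negbTE ->.
have dX : is_derive (x j) (1 : R) (fun t =>
  t ^+ e j) ((e j)%:R * x j ^+ (e j).-1).
  have := is_deriveX (e j) (is_derive_id (x j) (1 : R)).
  by rewrite exprfctE /GRing.scale /= mulr1.
apply: is_derive_eq (is_deriveM (is_derive_cst c (x j) (1 : R)) dX) _.
by rewrite /GRing.scale /= mulr0 addr0.
Qed.

Lemma monomial_euler j e x : x j * ((e j)%:R * monomial (decr j e) x) =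
  (e j)%:R * monomial e x.
Proof.
rewrite /monomial [in LHS](bigD1 j) //= [in RHS](bigD1 j) //= /decr eqxx.
have -> : \prod_(i < m | i != j) x i ^+ (if i == j then (e i).-1 else e i) =
    \prod_(i < m | i != j) x i ^+ e i by apply: eq_bigr => i /negbTE ->.
by case: (e j) => [|n] /=; rewrite ?exprS; ring.
Qed.

End PartialDerivatives.

(** * Derivatives of P and of x P: Euler identities, harmonicity, Dirac operator *)

Section SphericalMonogenics.
Variables (R : realType) (m k : nat) (P : ('I_m -> R) -> Cl R m).
Implicit Types (x y : 'I_m -> R) (i j : 'I_m) (A : {set 'I_m}).

Lemma hpoly_derivatives : is_hpoly k P ->
  exists (P1 : 'I_m -> ('I_m -> R) -> Cl R m)
         (P2 : 'I_m -> 'I_m -> ('I_m -> R) -> Cl R m),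
  [/\ forall j x A, is_pd j (P ^~ A) x (P1 j x A),
      forall i j x A, is_pd i (P1 j ^~ A) x (P2 i j x A),
      forall i j x A, P2 i j x A = P2 j i x A &
      forall x A, \sum_j x j * P1 j x A = k%:R * P x A].
Proof.
move=> [c cP].
pose I := {ffun 'I_m -> 'I_k.+1}.
pose e (a : I) j : nat := a j.
(* With the degree condition moved into the coefficient, sums are unconditional and differentiated
   term by term; the condition returns only for Euler's identity. *)
pose d (a : I) A : R := if (\sum_j e a j == k)%N then c a A else 0.
have PE x A : P x A = \sum_(a : I) d a A * monomial (e a) x.
  rewrite cP big_mkcond; apply: eq_bigr => a _; rewrite /d /e.
  by case: ifP; rewrite ?mul0r.
exists (fun j x A => \sum_(a : I) d a A * ((e a j)%:R *
  monomial (decr j (e a)) x)).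
exists (fun i j x A => \sum_(a : I) d a A * ((e a j)%:R *
   ((decr j (e a) i)%:R * monomial (decr i (decr j (e a))) x))).
split.
- move=> j x A; rewrite (_ : P ^~ A = fun x =>
  \sum_(a : I) d a A * monomial (e a) x).
    by apply: is_pd_sum => a; apply: is_pdZ; exact: is_pd_monomial.
  by apply/funext => y; rewrite PE.
- move=> i j x A; apply: is_pd_sum => a; do 2 apply: is_pdZ.
  exact: is_pd_monomial.
- move=> i j x A; apply: eq_bigr => a _; congr (_ * _).
  case: (eqVneq i j) => [-> //|ij]; rewrite /decr (negbTE ij) eq_sym (negbTE
    ij).
  rewrite mulrCA; congr (_ * (_ * _)); apply: eq_bigr => l _.
  by case: eqP => // ->; rewrite (negbTE ij).
- move=> x A; under eq_bigr do rewrite mulr_sumr.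
  rewrite exchange_big PE mulr_sumr; apply: eq_bigr => a _.
  under eq_bigr do rewrite mulrCA monomial_euler.
  rewrite -mulr_sumr -mulr_suml -natr_sum /d mulrCA.
  by case: eqP => [->|_] //; rewrite !mul0r !mulr0.
Qed.

Lemma is_pd_clmule i j x (g : ('I_m -> R) -> Cl R m) (d : Cl R m) A :
  (forall B, is_pd i (g ^~ B) x (d B)) ->
  is_pd i (fun y => clmule j (g y) A) x (clmule j d A).
Proof.
move=> gd; rewrite clmuleE (_ : (fun _ => _) =
  (fun y => blade_sign R [set j] (symdiff [set j] A) *
    g y (symdiff [set j] A))).
  exact: is_pdZ.
by apply/funext => y; rewrite clmuleE.
Qed.

Definition vecP x : Cl R m := clmulv x (P x).

Lemma is_pd_clmulv i x (g : ('I_m -> R) -> Cl R m) (d : Cl R m) A :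
  (forall B, is_pd i (g ^~ B) x (d B)) ->
  is_pd i (fun y => clmulv y (g y) A) x (clmule i (g x) A + clmulv x d A).
Proof.
move=> gd; apply: is_pd_eq (is_pd_sum _
  (fun j => is_pdM (is_pd_coord j i x) (is_pd_clmule j A gd))) _.
rewrite big_split; congr (_ + _); rewrite (bigD1 i) //= eqxx mul1r big1 ?addr0
  //.
by move=> j /negbTE ->; rewrite mul0r.
Qed.

(** Applied to a symmetric array of second derivatives, this says that the square of the Dirac
    operator is minus the Laplacian. *)
Lemma clmule_double_sum (c : 'I_m -> 'I_m -> Cl R m) A :
  (forall i j B, c i j B = c j i B) ->
  \sum_i clmule i (fun B => \sum_j clmule j (c i j) B) A = - \sum_i c i i A.
Proof.
move=> cC.
have E i : clmule i (fun B => \sum_j clmule j (c i j) B) A =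
    \sum_j clmule i (clmule j (c i j)) A.
  by rewrite clmuleE mulr_sumr; apply: eq_bigr => j _; rewrite [RHS]clmuleE.
under eq_bigr do rewrite E.
apply: (@mulfI _ 2); first by rewrite pnatr_eq0.
rewrite mulr_natl mulr2n [X in X + _]exchange_big /= -big_split /=.
rewrite mulrN mulr_sumr -sumrN; apply: eq_bigr => i _.
rewrite -big_split (bigD1 i) //= big1 ?addr0 => [|j ji].
  by rewrite clmuleK; ring.
rewrite (clmule_anticomm _ _ ji) (_ : c j i = c i j) ?addNr //.
exact/funext.
Qed.

(** P is harmonic because the Dirac operator squares to minus the Laplacian. For x P, d_j (x P) =
    e_j P + x d_j P, so its Laplacian is twice the Dirac operator on P plus x times the Laplacian of
    P, that is 0. Moving e_j past x yields -m P from the e_j^2 and -2 k P from Euler's identity. *)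
Lemma monogenic_derivatives : is_hpoly k P ->
  (forall x A, dirac_op P x A = 0) ->
  exists P1 P2 Q1 Q2 : 'I_m -> ('I_m -> R) -> Cl R m,
  [/\ [/\ forall j x A, is_pd j (P ^~ A) x (P1 j x A),
      forall j x A, is_pd j (P1 j ^~ A) x (P2 j x A),
      forall x A, \sum_j x j * P1 j x A = k%:R * P x A,
      forall x A, \sum_j P2 j x A = 0 &
      forall x A, \sum_j clmule j (P1 j x) A = 0] &
   [/\ forall j x A, is_pd j (vecP ^~ A) x (Q1 j x A),
      forall j x A, is_pd j (Q1 j ^~ A) x (Q2 j x A),
      forall x A, \sum_j x j * Q1 j x A = k.+1%:R * vecP x A,
      forall x A, \sum_j Q2 j x A = 0 &
      forall x A, \sum_j clmule j (Q1 j x) A = - (2 * k + m)%:R * P x A]].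
Proof.
move=> /hpoly_derivatives[P1 [P2 [dP dP1 P2C eulerP]]] monP.
have dirac0 x A : \sum_j clmule j (P1 j x) A = 0.
  rewrite -[RHS](monP x A) /dirac_op; apply: eq_bigr => j _;
    congr (clmul _ _ A).
  by apply/funext => B; rewrite /pdx derive1E; have [_ ->] := dP j x B.
have dirac1 i x A : \sum_j clmule j (P2 i j x) A = 0.
  apply: (@is_pd_unique _ _ i (fun y => \sum_j clmule j (P1 j y) A) x).
    by apply: is_pd_sum => j; exact: is_pd_clmule.
  rewrite (_ : (fun _ => _) = fun=> 0); first exact: is_pd_cst.
  by apply/funext => y; rewrite dirac0.
have lap0 x A : \sum_j P2 j j x A = 0.
  apply: oppr_inj; rewrite oppr0 -(clmule_double_sum A (c :=
    fun i j => P2 i j x)).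
    by apply: big1 => i _; rewrite clmuleE dirac1 mulr0.
  by move=> i j B; exact: P2C.
exists P1, (fun j => P2 j j).
exists (fun j x A => clmule j (P x) A + clmulv x (P1 j x) A).
exists (fun j x A => clmule j (P1 j x) A + (clmule j (P1 j x) A +
  clmulv x (P2 j j x) A)).
split; split => //.
- by move=> j x A; exact: is_pd_clmulv.
- move=> j x A; apply: is_pdD; first exact: is_pd_clmule.
  exact: is_pd_clmulv.
- move=> x A; rewrite -natr1 mulrDl mul1r addrC.
  under eq_bigr do rewrite mulrDr.
  rewrite big_split /=; congr (_ + _).
  rewrite /vecP /clmulv; under eq_bigr do rewrite mulr_sumr.
  rewrite exchange_big mulr_sumr; apply: eq_bigr => j _ /=.
  rewrite clmuleE (_ : k%:R * _ = x j * (blade_sign R [set j] (symdiff [set j]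
    A) *
    \sum_i x i * P1 i x (symdiff [set j] A))); last by rewrite eulerP; ring.
  by rewrite !mulr_sumr; apply: eq_bigr => i _; rewrite clmuleE; ring.
- move=> x A; rewrite !big_split /= dirac0 !add0r /clmulv exchange_big big1 //
  => j _.
  rewrite -mulr_sumr; under eq_bigr do rewrite clmuleE.
  by rewrite -mulr_sumr lap0 !mulr0.
- move=> x A.
  have E j : clmule j (fun B => clmule j (P x) B + clmulv x (P1 j x) B) A =
      - P x A - clmulv x (clmule j (P1 j x)) A - 2 * (x j * P1 j x A).
    have := clmuleD j 1 1 (clmule j (P x)) (clmulv x (P1 j x)) A.
    rewrite clmuleK clmule_vec !mul1r => H.
    transitivity (- P x A + (- clmulv x (clmule j (P1 j x)) A - 2 * x j *
      P1 j x A)).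
      by rewrite -H; congr (clmule _ _ A); apply/funext => B; rewrite !mul1r.
    by ring.
  under eq_bigr do rewrite E.
  rewrite !sumrB -mulr_sumr eulerP sumrN sumr_const card_ord.
  have -> : \sum_j clmulv x (clmule j (P1 j x)) A = 0.
    rewrite /clmulv exchange_big big1 // => i _; rewrite -mulr_sumr.
    under eq_bigr do rewrite clmuleE.
    by rewrite -mulr_sumr dirac0 !mulr0.
  by rewrite natrD natrM -mulr_natl; ring.
Qed.

End SphericalMonogenics.

(** * The Laplacian and the Dirac operator on radial multiples *)

Section RadialCalculus.
Local Open Scope classical_set_scope.
Variables (R : realType) (m : nat).
Implicit Types (x y : 'I_m -> R) (j : 'I_m) (a b : nat -> nat -> R)
  (N : nat) (A : {set 'I_m}).

Lemma derive1_near (f g : R -> R) (t d : R) : is_derive t (1 : R) g d ->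
  (\forall u \near t, f u = g u) -> derive1 f t = d.
Proof.
move=> gd fg; rewrite derive1E.
by have [_ ->] : is_derive t (1 : R) f d
  by apply: near_eq_is_derive gd; apply: filterS fg => u ->.
Qed.

Lemma near_norm_lt (x0 X0 : R) : `|x0| < X0 -> \forall t \near x0, `|t| < X0.
Proof.
by move=> xX; have /cvgr_norm_lt : id t @[t --> x0] --> x0 by []; exact.
Qed.

Section Harmonic.
Variables (H : ('I_m -> R) -> R) (H1 H2 : 'I_m -> ('I_m -> R) -> R) (d : nat).
Hypothesis dH : forall j x, is_pd j H x (H1 j x).
Hypothesis dH1 : forall j x, is_pd j (H1 j) x (H2 j x).
Hypothesis euler : forall x, \sum_j x j * H1 j x = d%:R * H x.
Hypothesis harmonic : forall x, \sum_j H2 j x = 0.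

Definition radial_pd (phi phi1 : R -> R) j x : R :=
  phi1 (sqnorm x) * (2 * x j) * H x + phi (sqnorm x) * H1 j x.

Definition radial_pd2 (phi phi1 phi2 : R -> R) j x : R :=
  (phi2 (sqnorm x) * (2 * x j) ^+ 2 + phi1 (sqnorm x) * 2) * H x
  + phi1 (sqnorm x) * (2 * x j) * H1 j x
  + (phi1 (sqnorm x) * (2 * x j) * H1 j x + phi (sqnorm x) * H2 j x).

Lemma is_pd_radial1 (phi phi1 : R -> R) j x :
  is_derive (sqnorm x) (1 : R) phi (phi1 (sqnorm x)) ->
  is_pd j (fun y => phi (sqnorm y) * H y) x (radial_pd phi phi1 j x).
Proof. by move=> dp; exact: is_pdM (is_pd_radial j dp) (dH j x). Qed.

Lemma is_pd_radial2 (phi phi1 phi2 : R -> R) j x :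
  is_derive (sqnorm x) (1 : R) phi (phi1 (sqnorm x)) ->
  is_derive (sqnorm x) (1 : R) phi1 (phi2 (sqnorm x)) ->
  is_pd j (radial_pd phi phi1 j) x (radial_pd2 phi phi1 phi2 j x).
Proof.
move=> dp dp1.
have d2 := is_pdZ 2 (is_pd_coord j j x).
apply: is_pd_eq (is_pdD (is_pdM (is_pdM (is_pd_radial j dp1) d2) (dH j x))
  (is_pdM (is_pd_radial j dp) (dH1 j x))) _.
by rewrite /radial_pd2 eqxx mulr1; ring.
Qed.

(** 4 s is the squared gradient of s, 2 m its Laplacian, and 4 d twice the pairing of the gradients
    of s and H, evaluated by Euler's identity. *)
Lemma sum_radial_pd2 (phi phi1 phi2 : R -> R) x :
  \sum_j radial_pd2 phi phi1 phi2 j x =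
  (4 * (sqnorm x * phi2 (sqnorm x)) + (2 * m +
    4 * d)%:R * phi1 (sqnorm x)) * H x.
Proof.
transitivity (\sum_j (4 * phi2 (sqnorm x) * H x * x j ^+ 2 +
  2 * phi1 (sqnorm x) * H x +
    4 * phi1 (sqnorm x) * (x j * H1 j x) + phi (sqnorm x) * H2 j x)).
  by apply: eq_bigr => j _; rewrite /radial_pd2; ring.
rewrite !big_split /= -!mulr_sumr euler harmonic sumr_const card_ord -/(sqnorm
  x).
by rewrite -mulr_natl; ring.
Qed.

End Harmonic.

Lemma psum2_flap X0 S0 a w (x0 s : R) : 0 < X0 -> conv2 X0 S0 a ->
  `|x0| < X0 -> `|s| < S0 ->
  psum2 (flap w a) x0 s = psum2 (diff0 (diff0 a)) x0 s +
    (4 * (s * psum2 (diffs (diffs a)) x0 s) + w%:R * psum2 (diffs a) x0 s).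
Proof.
move=> X00 ca xX sS.
have c1 := conv2_diff0 (conv2_diff0 ca); have cd := conv2_diffs ca.
have cw := conv2Z 4 (conv2_weight cd); have cz := conv2Z w%:R cd.
have -> : flap w a = fun p l => diff0 (diff0 a) p l +
    (4 * (l%:R * diffs a p l) + w%:R * diffs a p l).
  apply/funext => p; apply/funext => l.
  by rewrite /flap natrD natrM mulrDl mulrA.
rewrite (psum2D X00 c1 (conv2D cw cz) xX sS) (psum2D X00 cw cz xX sS).
rewrite (psum2Z 4 X00 (conv2_weight cd) xX sS) (psum2Z w%:R X00 cd xX sS).
by rewrite (psum2_weight X00 cd xX sS).
Qed.

Section Monogenic.
Variables (k N : nat) (P : ('I_m -> R) -> Cl R m).
Hypothesis hN : (2 * k + m = 2 * N + 1)%N.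
Hypothesis hP : is_hpoly k P.
Hypothesis monP : forall x A, dirac_op P x A = 0.

(** The formula for [F] is assumed on a whole open set because each derivative replaces the function
    near the point by its series; the conclusion has the same shape and domain, which permits
    iteration. The constants are 2 m + 4 d for the degrees d = k and d = k + 1. *)
Lemma lap_radial (X0 S0 : R) a b (F : R -> ('I_m -> R) -> Cl R m) :
  0 < X0 -> conv2 X0 S0 a -> conv2 X0 S0 b ->
  (forall (x0 : R) x A, `|x0| < X0 -> sqnorm x < S0 ->
    F x0 x A = psum2 a x0 (sqnorm x) * P x A +
      psum2 b x0 (sqnorm x) * vecP P x A) ->
  forall (x0 : R) x A, `|x0| < X0 -> sqnorm x < S0 ->
    lap F x0 x A = psum2 (flap (4 * N + 2) a) x0 (sqnorm x) * P x A +
                   psum2 (flap (4 * N + 6) b) x0 (sqnorm x) * vecP P x A.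
Proof.
move=> X00 ca cb FE x0 x A xX sS.
have [P1 [P2 [Q1 [Q2 [[dP dP1 eP lP _] [dQ dQ1 eQ lQ _]]]]]] :=
  monogenic_derivatives hP monP.
have Sabs y : sqnorm y < S0 -> `|sqnorm y| < S0 by rewrite ger0_norm
  ?sqnorm_ge0.
have S00 : 0 < S0 by apply: le_lt_trans sS; exact: sqnorm_ge0.
have dx0 c e t y : conv2 X0 S0 c -> conv2 X0 S0 e -> `|t| < X0 ->
  sqnorm y < S0 ->
    is_derive t (1 : R) (fun u => psum2 c u (sqnorm y) * P y A +
      psum2 e u (sqnorm y) * vecP P y A)
    (psum2 (diff0 c) t (sqnorm y) * P y A +
      psum2 (diff0 e) t (sqnorm y) * vecP P y A).
  move=> cc ce tX yS.
  have d1 := is_derive_psum2_x X00 cc tX (Sabs _ yS).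
  have d2 := is_derive_psum2_x X00 ce tX (Sabs _ yS).
  apply: is_derive_eq (is_deriveD (is_deriveM d1 (is_derive_cst (P y A) t (1 :
    R)))
    (is_deriveM d2 (is_derive_cst (vecP P y A) t (1 : R)))) _.
  by rewrite /GRing.scale /=; ring.
have pd0F t y : `|t| < X0 -> sqnorm y < S0 -> pd0 F t y A =
    psum2 (diff0 a) t (sqnorm y) * P y A +
      psum2 (diff0 b) t (sqnorm y) * vecP P y A.
  move=> tX yS; apply: derive1_near (dx0 _ _ _ _ ca cb tX yS) _.
  by apply: filterS (near_norm_lt tX) => u uX; rewrite FE.
have pd00F : pd0 (pd0 F) x0 x A = psum2 (diff0 (diff0 a)) x0 (sqnorm x) *
  P x A +
    psum2 (diff0 (diff0 b)) x0 (sqnorm x) * vecP P x A.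
  apply: derive1_near (dx0 _ _ _ _ (conv2_diff0 ca) (conv2_diff0 cb) xX sS) _.
  by apply: filterS (near_norm_lt xX) => u uX; rewrite pd0F.
have ds c y : conv2 X0 S0 c -> sqnorm y < S0 ->
    is_derive (sqnorm y) (1 : R) (psum2 c x0) (psum2 (diffs c) x0 (sqnorm y)).
  by move=> cc yS; exact: (is_derive_psum2_s X00 S00 cc xX (Sabs _ yS)).
have pdjF j y : sqnorm y < S0 -> pdj j F x0 y A =
    radial_pd (P ^~ A) (fun j => P1 j ^~ A) (psum2 a x0) (psum2 (diffs a) x0) j
      y +
    radial_pd (vecP P ^~ A) (fun j => Q1 j ^~ A) (psum2 b x0) (psum2 (diffs b)
      x0) j y.
  move=> yS; apply: (@derive1_pd _ _ j (F x0 ^~ A) (fun z =>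
    psum2 a x0 (sqnorm z) * P z A + psum2 b x0 (sqnorm z) * vecP P z A));
      last first.
    by apply: filterS (near_sqnorm_lt j yS) => u uS; rewrite FE.
  apply: is_pdD.
    exact: (is_pd_radial1 (fun j x => dP j x A) _ (ds _ _ ca yS)).
  exact: (is_pd_radial1 (fun j x => dQ j x A) _ (ds _ _ cb yS)).
have pdjjF j : pdj j (pdj j F) x0 x A =
    radial_pd2 (P ^~ A) (fun j => P1 j ^~ A) (fun j => P2 j ^~ A)
      (psum2 a x0) (psum2 (diffs a) x0) (psum2 (diffs (diffs a)) x0) j x +
    radial_pd2 (vecP P ^~ A) (fun j => Q1 j ^~ A) (fun j => Q2 j ^~ A)
      (psum2 b x0) (psum2 (diffs b) x0) (psum2 (diffs (diffs b)) x0) j x.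
  apply: (@derive1_pd _ _ j (pdj j F x0 ^~ A) (fun y =>
    radial_pd (P ^~ A) (fun j => P1 j ^~ A) (psum2 a x0) (psum2 (diffs a) x0) j
      y +
    radial_pd (vecP P ^~ A) (fun j => Q1 j ^~ A) (psum2 b x0) (psum2 (diffs b)
      x0) j y));
    last first.
    by apply: filterS (near_sqnorm_lt j sS) => u uS; rewrite pdjF.
  have [da db] := (conv2_diffs ca, conv2_diffs cb).
  apply: is_pdD.
    exact: (is_pd_radial2 (fun j x => dP j x A) (fun j x => dP1 j x A) _
      (ds _ _ ca sS) (ds _ _ da sS)).
  exact: (is_pd_radial2 (fun j x => dQ j x A) (fun j x => dQ1 j x A) _
    (ds _ _ cb sS) (ds _ _ db sS)).
rewrite /lap pd00F; under eq_bigr do rewrite pdjjF.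
rewrite big_split /=.
rewrite (sum_radial_pd2 (fun x => eP x A) (fun x => lP x A)).
rewrite (sum_radial_pd2 (fun x => eQ x A) (fun x => lQ x A)).
rewrite (psum2_flap _ X00 ca xX (Sabs _ sS)) (psum2_flap _ X00 cb xX (Sabs _
  sS)).
have -> : (2 * m + 4 * k = 4 * N + 2)%N by lia.
have -> : (2 * m + 4 * k.+1 = 4 * N + 6)%N by lia.
by ring.
Qed.

(** After q' Laplacians the arrays solve the system with M = q', whence the factor 4 (N - q') of the
    next one. *)
Fixpoint lap_coef (q : nat) a : nat -> nat -> R :=
  if q is q'.+1 then fun p l => (4 * (N - q'))%:R *
    diffs (lap_coef q' a) p l else a.

Lemma lap_coefE q a p l : lap_coef q a p l =
  (\prod_(i < q) (4 * (N - i)))%:R * iter q (@diffs R) a p l.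
Proof.
elim: q p l => [|q IH] p l; first by rewrite big_ord0 mul1r.
by rewrite /= /diffs IH big_ord_recr /= [in RHS]natrM; ring.
Qed.

Lemma conv2_lap_coef X0 S0 q a : conv2 X0 S0 a -> conv2 X0 S0 (lap_coef q a).
Proof. by move=> ca; elim: q => //= q IH; apply: conv2Z;
  exact: conv2_diffs. Qed.

Lemma vekua_lap_coef q a b : vekua 0 a b ->
  vekua q (lap_coef q a) (lap_coef q b).
Proof. by move=> ab; elim: q => //= q IH; apply: vekuaZ;
  exact: vekua_diffs. Qed.

Lemma iter_lap_radial (X0 S0 : R) a b (F : R -> ('I_m -> R) -> Cl R m) q :
  0 < X0 -> conv2 X0 S0 a -> conv2 X0 S0 b -> vekua 0 a b ->
  (forall (x0 : R) x A, `|x0| < X0 -> sqnorm x < S0 ->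
    F x0 x A = psum2 a x0 (sqnorm x) * P x A +
      psum2 b x0 (sqnorm x) * vecP P x A) ->
  (q <= N)%N -> forall (x0 : R) x A, `|x0| < X0 -> sqnorm x < S0 ->
    iter q (@lap R m) F x0 x A = psum2 (lap_coef q a) x0 (sqnorm x) * P x A +
      psum2 (lap_coef q b) x0 (sqnorm x) * vecP P x A.
Proof.
move=> X00 ca cb ab FE; elim: q => [_ //|q IH qN] x0 x A xX sS.
rewrite iterS (lap_radial X00 (conv2_lap_coef q ca) (conv2_lap_coef q cb) (IH
  (ltnW qN))) //.
have flapE p l := flap_vekua p l (ltnW qN) (vekua_lap_coef q ab).
have -> : flap (4 * N + 2) (lap_coef q a) = lap_coef q.+1 a.
  by apply/funext => p; apply/funext => l; exact: (flapE p l).1.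
have -> // : flap (4 * N + 6) (lap_coef q b) = lap_coef q.+1 b.
by apply/funext => p; apply/funext => l; exact: (flapE p l).2.
Qed.

Lemma conv1_iter_fdirac S0 p (fg : (nat -> R) * (nat -> R)) :
  conv1 S0 fg.1 -> conv1 S0 fg.2 ->
  conv1 S0 (iter p (fdirac N) fg).1 /\ conv1 S0 (iter p (fdirac N) fg).2.
Proof.
move=> cf cg; elim: p => //= p [IH1 IH2]; split; last first.
  by apply: conv1Z; exact: conv1_diffs.
have := conv1D (conv1Z (-2) (conv1_weight IH2)) (conv1Z (- (2 * N + 1)%:R) IH2).
rewrite (_ : (fun n => _) = (fun l => - ((2 * l + 2 * N +
  1)%:R * (iter p (fdirac N) fg).2 l))) //.
by apply/funext => l; rewrite -addnA [(2 * l + _)%:R]natrD natrM; ring.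
Qed.

Lemma psum_fdirac S0 (fg : (nat -> R) * (nat -> R)) s :
  conv1 S0 fg.1 -> conv1 S0 fg.2 -> `|s| < S0 ->
  psum (fdirac N fg).1 s =
    - (2 * (s * psum (pseries_diffs fg.2) s) + (2 * N + 1)%:R * psum fg.2 s) /\
  psum (fdirac N fg).2 s = 2 * psum (pseries_diffs fg.1) s.
Proof.
move=> cf cg sS; split; last exact: psumZ (conv1_diffs cf) sS.
rewrite -(psum_weight cg sS) opprD -!mulNr.
rewrite -(psumZ _ (conv1_weight cg) sS) -(psumZ _ cg sS).
rewrite -(psumD (conv1Z _ (conv1_weight cg)) (conv1Z _ cg) sS); congr psum.
by apply/funext => l /=; rewrite -addnA [(2 * l + _)%:R]natrD natrM; ring.
Qed.

(** The gradient of a radial factor is 2 x times its derivative in s; it turns P into x P, and x P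
    into x x P = -s P. *)
Lemma dirac_radial S0 (f g : nat -> R) (G : ('I_m -> R) -> Cl R m) :
  conv1 S0 f -> conv1 S0 g ->
  (forall x A, sqnorm x < S0 ->
    G x A = psum f (sqnorm x) * P x A + psum g (sqnorm x) * vecP P x A) ->
  forall x A, sqnorm x < S0 ->
    dirac_op G x A = psum (fdirac N (f, g)).1 (sqnorm x) * P x A +
                     psum (fdirac N (f, g)).2 (sqnorm x) * vecP P x A.
Proof.
move=> cf cg GE x A sS.
have [P1 [P2 [Q1 [Q2 [[dP _ _ _ diracP] [dQ _ _ _ diracQ]]]]]] :=
  monogenic_derivatives hP monP.
have sabs : `|sqnorm x| < S0 by rewrite ger0_norm ?sqnorm_ge0.
have df := is_derive_psum cf sabs; have dg := is_derive_psum cg sabs.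
pose D j : Cl R m := fun B =>
  radial_pd (P ^~ B) (fun j => P1 j ^~ B) (psum f) (psum (pseries_diffs f)) j x
    +
  radial_pd (vecP P ^~ B) (fun j => Q1 j ^~ B) (psum g) (psum (pseries_diffs g))
    j x.
have pdG j : pdx j G x = D j.
  apply/funext => B; apply: (@derive1_pd _ _ j (G ^~ B) (fun z =>
    psum f (sqnorm z) * P z B + psum g (sqnorm z) * vecP P z B)); last first.
    by apply: filterS (near_sqnorm_lt j sS) => u uS; rewrite GE.
  apply: is_pdD.
    exact: (is_pd_radial1 (fun j x => dP j x B) _ df).
  exact: (is_pd_radial1 (fun j x => dQ j x B) _ dg).
rewrite /dirac_op; under eq_bigr do rewrite pdG -/(clmule _ _).
have [-> ->] := @psum_fdirac _ (f, g) _ cf cg sabs; rewrite /= -hN.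
set s := sqnorm x.
have -> : \sum_j clmule j (D j) A =
    2 * psum (pseries_diffs f) s * vecP P x A +
    psum f s * (\sum_j clmule j (P1 j x) A) +
    2 * psum (pseries_diffs g) s * clmulv x (vecP P x) A +
    psum g s * (\sum_j clmule j (Q1 j x) A).
  rewrite /(vecP P x A) /clmulv !mulr_sumr -!big_split; apply: eq_bigr => j _.
  by rewrite !clmuleE /D /radial_pd -/s /=; ring.
by rewrite diracP diracQ [clmulv x (vecP P x) A]clmulvK -/(sqnorm x) -/s; ring.
Qed.

Lemma iter_dirac_radial S0 (f : nat -> R) (G : ('I_m -> R) -> Cl R m) p :
  conv1 S0 f -> (forall x A, sqnorm x < S0 ->
    G x A = psum f (sqnorm x) * P x A) ->
  forall x A, sqnorm x < S0 ->
    iter p (@dirac_op R m) G x A =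
      psum (iter p (fdirac N) (f, fun=> 0)).1 (sqnorm x) * P x A +
      psum (iter p (fdirac N) (f, fun=> 0)).2 (sqnorm x) * vecP P x A.
Proof.
move=> cf GE.
have c0 : conv1 S0 (fun=> 0 : R).
  by move=> S _; exists 0 => _ n; rewrite normr0 mul0r.
have cp q := @conv1_iter_fdirac S0 q (f, fun=> 0) cf c0.
elim: p => [|p IH] x A sS /=.
  rewrite GE // [psum (fun=> 0) _](_ : _ = 0) ?mul0r ?addr0 //.
  apply: cvg_lim => //; rewrite (_ : pseries _ _ = fun=> 0);
    first exact: cvg_cst.
  by apply/funext => n; rewrite /pseries /series /= big1 // => i _;
    rewrite mul0r.
by have := dirac_radial (cp p).1 (cp p).2 IH A sS; rewrite -surjective_pairing.
Qed.

End Monogenic.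
End RadialCalculus.

(** * The Fueter and Cauchy-Kovalevskaya coefficients *)

Lemma dfact_double n : dfact (2 * n) = (2 ^ n * n`!)%N.
Proof.
elim: n => [//|n IH]; rewrite mulnS.
rewrite [LHS]/(((2 * n).+2) * dfact (2 * n))%N IH expnS factS; nia.
Qed.

Lemma prod_lap_factor N : (\prod_(i < N) (4 * (N - i)) =
  2 ^ N * dfact (2 * N))%N.
Proof.
rewrite dfact_double mulnA -expnMn -[(2 * 2)%N]/4%N.
rewrite big_split /= prod_nat_const card_ord; congr (_ * _)%N.
elim: N => [|N IH]; first by rewrite big_ord0.
by rewrite big_ord_recl factS -IH subn0; congr (_ * _)%N; apply: eq_bigr.
Qed.

Section InitialCoefficients.
Variable R : realType.

(** The first N factors of the falling product of alpha + N are alpha + N, ..., alpha + 1; the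
    remaining l form that of alpha. *)
Lemma gbinom_shift (alpha : R) N l :
  (l + N)`!%:R / l`!%:R * gbinom (alpha + N%:R) (l + N) =
  (\prod_(j < N) (alpha + j.+1%:R)) * gbinom alpha l.
Proof.
have f0 n : (n`!)%:R != 0 :> R by rewrite pnatr_eq0 -lt0n fact_gt0.
rewrite /gbinom addnC big_split_ord /=.
have -> : \prod_(i < N) (alpha + N%:R - i%:R) = \prod_(j < N) (alpha + j.+1%:R).
  rewrite (reindex_inj rev_ord_inj) /=; apply: eq_bigr => i _.
  by rewrite natrB //; ring.
have -> : \prod_(i < l) (alpha + N%:R - (N + i)%:R) =
  \prod_(i < l) (alpha - i%:R).
  by apply: eq_bigr => i _; rewrite natrD; ring.
by field; rewrite !f0.
Qed.

(** At x_0 = 0 one has z^2 = -s: the N shifts contribute (-1)^N, which joins 2^N to give (-2)^N. *)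
Lemma lap_coef_re0 (alpha : R) N l :
  lap_coef N N (re_coef (even_coef (gbinom (alpha + N%:R)))) 0 l =
  (-2) ^+ N * (dfact (2 * N))%:R * (\prod_(j < N) (alpha + j.+1%:R)) *
    ((-1) ^+ l * gbinom alpha l).
Proof.
rewrite lap_coefE prod_lap_factor iter_diffs /re_coef add0n binn mulr1.
rewrite /even_coef !mul2n odd_double doubleK natrM natrX.
transitivity (2 ^+ N * (dfact N.*2)%:R * (-1) ^+ (l + N) *
  ((l + N)`!%:R / l`!%:R * gbinom (alpha + N%:R) (l + N))); first by ring.
rewrite gbinom_shift exprD -[- 2]mulN1r exprMn; ring.
Qed.

(** An even series in z is real on the imaginary axis: only odd coefficients occur here. *)
Lemma lap_coef_im0 (c : nat -> R) N l : lap_coef N N (im_coef (even_coef c)) 0 l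
  = 0.
Proof.
by rewrite lap_coefE iter_diffs /im_coef /even_coef add0n mul2n /= odd_double
  !mul0r !mulr0.
Qed.

End InitialCoefficients.

(** * Comparison of the Fueter image with the Cauchy-Kovalevskaya series *)

Section Assembly.
Local Open Scope classical_set_scope.
Variables (R : realType) (m k N : nat) (alpha : R) (P : ('I_m -> R) -> Cl R m).
Hypothesis hN : (2 * k + m = 2 * N + 1)%N.
Hypothesis hP : is_hpoly k P.
Hypothesis monP : forall x A, dirac_op P x A = 0.

Lemma sqr_normx (x : 'I_m -> R) : normx x ^+ 2 = sqnorm x.
Proof. by rewrite sqr_sqrtr ?sqnorm_ge0. Qed.

Lemma vecP_normx0 (x : 'I_m -> R) A : normx x = 0 -> vecP P x A = 0.
Proof.
move=> x0; rewrite /vecP /clmulv big1 // => j _.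
have : sqnorm x = 0 by rewrite -sqr_normx x0 expr0n.
move/eqP; rewrite psumr_eq0 => [/allP /(_ j (mem_index_enum j))|i _];
  last exact: sqr_ge0.
by rewrite /= sqrf_eq0 => /eqP ->; rewrite mul0r.
Qed.

Lemma Ft_binom_initial (gamma X0 S0 : R) x0 (x : 'I_m -> R) A :
  0 <= S0 -> X0 + Num.sqrt S0 <= 1 -> `|x0| < X0 -> sqnorm x < S0 ->
  clmul (cladd (clscal (binom_re gamma x0 (normx x)))
     (clscale (binom_im gamma x0 (normx x) / normx x) (clvec x))) (P x) A =
  psum2 (re_coef (even_coef (gbinom gamma))) x0 (sqnorm x) * P x A +
  psum2 (im_coef (even_coef (gbinom gamma))) x0 (sqnorm x) * vecP P x A.
Proof.
move=> S00 XS xX xS; rewrite clmul_paravector -/(vecP P x).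
have nS : `|normx x ^+ 2| < S0 by rewrite sqr_normx ger0_norm ?sqnorm_ge0.
have [-> ->] := binom_re_psum2 gamma S00 XS xX nS; rewrite sqr_normx.
(* At the origin the division by the norm is by 0, but x P vanishes there, so the radial formula
   still holds. *)
congr (_ + _); have [n0|n0] := eqVneq (normx x) 0.
  by rewrite vecP_normx0 // !mulr0.
by rewrite [normx x * _]mulrC mulfK.
Qed.

Lemma psum_alternating_gbinom (s : R) : 0 <= s < 1 ->
  psum (fun l => (-1) ^+ l * gbinom alpha l) s = (1 - s) `^ alpha.
Proof.
move=> /andP[s0 s1]; rewrite -gbinom_series;
  last by rewrite oppr_le0 s0 ltrN2 s1.
congr (limn (series _)); apply/funext => l /=.
by rewrite -[- s]mulN1r exprMn; ring.
Qed.

Lemma conv1_alternating_gbinom : conv1 1 (fun l => (-1) ^+ l * gbinom alpha l).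
Proof.
move=> S Sb; have /andP[S0 _] := Sb.
apply: cauchy_bounded_le S0 _ (conv1_gbinom alpha Sb) => _ n.
by rewrite normrM normrX normrN1 expr1n mul1r.
Qed.

Lemma Ft_CK (X0 S0 : R) x0 (x : 'I_m -> R) A :
  0 < X0 -> 0 <= S0 -> X0 + Num.sqrt S0 <= 1 -> S0 <= 1 ->
  `|x0| < X0 -> sqnorm x < S0 ->
  Ft N (binom_re (alpha + N%:R)) (binom_im (alpha + N%:R)) P x0 x A =
  (-2) ^+ N * (dfact (2 * N))%:R * (\prod_(j < N) (alpha + j.+1%:R)) *
    CK (fun z B => powR (1 - normx z ^+ 2) alpha * P z B) x0 x A.
Proof.
move=> X00 S00 XS S01 xX xS.
set c := even_coef (gbinom (alpha + N%:R)).
have cc : conv1 1 c := conv1_even_coef (conv1_gbinom _).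
have [cre cim] := (conv2_re_coef S00 XS cc, conv2_im_coef S00 XS cc).
rewrite /Ft (iter_lap_radial hN hP monP X00 cre cim (vekua_coef c) _ (leqnn N))
  //; last first.
  by move=> t y B tX yS; exact: (Ft_binom_initial _ _ S00 XS tX yS).
set a := lap_coef N N _; set b := lap_coef N N (im_coef c).
have [ca cb] : conv2 X0 S0 a /\ conv2 X0 S0 b by split; exact: conv2_lap_coef.
set K := (X in X * CK _ _ _ _).
pose f l := (-1) ^+ l * gbinom alpha l.
pose fg p := iter p (fdirac N) (f, fun=> 0).
have cf : conv1 1 f := conv1_alternating_gbinom.
have c0 : conv1 1 (fun=> 0 : R) by move=> S _; exists 0 => _ n;
  rewrite normr0 mul0r.
have cfg p := @conv1_iter_fdirac R N 1 p (f, fun=> 0) cf c0.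
have abE p l : a p l = (-1) ^+ p / (p`!)%:R * (K * (fg p).1 l) /\
               b p l = (-1) ^+ p / (p`!)%:R * (K * (fg p).2 l).
  rewrite /a /b; have [-> ->] := vekua_iter_fdirac p l (vekua_lap_coef N N
    (vekua_coef c)).
  have -> : lap_coef N N (re_coef c) 0%N = fun l => K * f l.
    by apply/funext => i; exact: lap_coef_re0.
  have -> : lap_coef N N (im_coef c) 0%N = fun=> 0.
    by apply/funext => i; exact: lap_coef_im0.
  by have [-> ->] := iter_fdiracZ N f K p l.
have s1 : `|sqnorm x| < S0 by rewrite ger0_norm ?sqnorm_ge0.
have s2 : `|sqnorm x| < 1 := lt_le_trans s1 S01.
have rowE p : psum (a p) (sqnorm x) = (-1) ^+ p / (p`!)%:R * (K *
  psum (fg p).1 (sqnorm x)) /\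
    psum (b p) (sqnorm x) = (-1) ^+ p / (p`!)%:R * (K *
      psum (fg p).2 (sqnorm x)).
  have [c1 c2] := cfg p.
  rewrite -!(psumZ K _ s2) // -!(psumZ _ (conv1Z K _) s2) //.
  by split; congr psum; apply/funext => l; have [] := abE p l.
have CKE : CK (fun z B => powR (1 - normx z ^+ 2) alpha * P z B) x0 x A =
    limn (series (fun n => (- x0) ^+ n / (n`!)%:R *
      (psum (fg n).1 (sqnorm x) * P x A +
        psum (fg n).2 (sqnorm x) * vecP P x A))).
  congr (limn (series _)); apply/funext => n; congr (_ * _).
  (* On the open unit ball the real power is its binomial series in s, so the iterated Dirac
     operator acts on coefficients. *)
  have GE z B : sqnorm z < 1 ->
      (1 - normx z ^+ 2) `^ alpha * P z B = psum f (sqnorm z) * P z B.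
    by move=> zS; rewrite psum_alternating_gbinom ?sqnorm_ge0 // sqr_normx.
  by apply: (iter_dirac_radial hN hP monP n cf GE);
    exact: le_lt_trans (ler_norm _) s2.
rewrite CKE; set u := (X in series X).
set v := fun n => psum (a n) (sqnorm x) * x0 ^+ n.
set w := fun n => psum (b n) (sqnorm x) * x0 ^+ n.
have cv : cvgn (series v) := conv1_cvg (conv2_row ca s1) xX.
have cw : cvgn (series w) := conv1_cvg (conv2_row cb s1) xX.
(* Convergence of the [CK] series is not proved directly: it is inherited from the rows of [a] and
   [b] on dividing by [K]. *)
have uE : K *: u = P x A *: v + vecP P x A *: w.
  apply/funext => n; rewrite /u /v /w.
  change (K * ((- x0) ^+ n / (n`!)%:R * (psum (fg n).1 (sqnorm x) * P x A +
      psum (fg n).2 (sqnorm x) * vecP P x A)) =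
    P x A * (psum (a n) (sqnorm x) * x0 ^+ n) +
    vecP P x A * (psum (b n) (sqnorm x) * x0 ^+ n)).
  have [-> ->] := rowE n; rewrite -[- x0]mulN1r exprMn; ring.
have cKu : limn (series (K *: u)) = psum2 a x0 (sqnorm x) * P x A +
  psum2 b x0 (sqnorm x) * vecP P x A.
  rewrite uE lim_seriesD; try exact: is_cvg_seriesZ.
  by rewrite !lim_seriesZ // mulrC [psum2 b _ _ * _]mulrC.
(* [K] vanishes when alpha is one of -1, ..., -N. Division is then impossible, but both sides are 0
   whatever the value of the limit. *)
rewrite -cKu; have [K0|K0] := eqVneq K 0.
  rewrite K0 scale0r mul0r; apply: cvg_lim => //.
  rewrite (_ : series _ = fun=> 0); first exact: cvg_cst.
  by apply/funext => n; rewrite /series /= big1.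
rewrite lim_seriesZ // (_ : u = K^-1 *: (K *: u));
  last by rewrite scalerA mulVf // scale1r.
by rewrite uE; apply/is_cvg_seriesZ/is_cvg_seriesD; exact: is_cvg_seriesZ.
Qed.

Lemma sqnorm_open (x : 'I_m -> R) (S0 : R) : sqnorm x < S0 ->
  exists2 eps, 0 < eps & forall y, (forall j, `|y j - x j| < eps) ->
    sqnorm y < S0.
Proof.
move=> xS; set B := \sum_j (2 * `|x j| + 1).
have B0 : 0 <= B by apply: sumr_ge0 => j _; rewrite addr_ge0 ?mulr_ge0.
(* The bound 1 on |y_j - x_j| makes the increment of each square linear in e; the summand 1 in the
   denominator makes e B < S0 - |x|^2 strict. *)
pose e := (S0 - sqnorm x) / (B + 1).
have e0 : 0 < e by rewrite divr_gt0 ?subr_gt0 // ltr_wpDl.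
exists (Num.min 1 e) => [|y yx]; first by rewrite lt_min ltr01 e0.
have step j : y j ^+ 2 <= x j ^+ 2 + e * (2 * `|x j| + 1).
  have := yx j; rewrite lt_min => /andP[d1 de].
  have -> : y j ^+ 2 = x j ^+ 2 + (y j - x j) * (2 * x j + (y j - x j)) by ring.
  rewrite lerD2l (le_trans (ler_norm _)) // normrM ler_pM //; first exact: ltW.
  rewrite (le_trans (ler_normD _ _)) // lerD ?(ltW d1) // normrM ger0_norm //.
have : sqnorm y <= sqnorm x + e * B.
  by rewrite /B mulr_sumr -big_split; apply: ler_sum => j _; exact: step.
have : e * (B + 1) = S0 - sqnorm x by rewrite /e divfK // gt_eqF // ltr_wpDl.
by rewrite mulrDr mulr1; lra.
Qed.

End Assembly.

Unset Implicit Arguments.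

Theorem theorem2 (R : realType) (m k : nat) (alpha : R)
  (P : ('I_m -> R) -> Cl R m) :
  odd m ->
  is_hpoly k P ->
  (forall x A, dirac_op P x A = 0) ->
  let N := (k + m.-1./2)%N in
  forall x : 'I_m -> R, 0 < normx x < 1 ->
  exists2 eps : R, 0 < eps &
    forall (y0 : R) (y : 'I_m -> R),
      `|y0| < eps -> (forall j, `|y j - x j| < eps) ->
      forall A : {set 'I_m},
        Ft N (binom_re (alpha + N%:R)) (binom_im (alpha + N%:R)) P y0 y A =
        (-2) ^+ N * (dfact (2 * k + m - 1))%:R
          * (\prod_(j < N) (alpha + j.+1%:R))
          * CK (fun z A' => powR (1 - normx z ^+ 2) alpha * P z A') y0 y A.
Proof.
move=> m_odd hP monP N x /andP[x0 x1].
have hN : (2 * k + m = 2 * N + 1)%N.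
  by rewrite /N; have := odd_double_half m; rewrite m_odd;
    case: (m) m_odd => //= n; lia.
have s1 : sqnorm x < 1 by rewrite -sqr_normx expr_lt1 // ltW.
have s0 := sqnorm_ge0 x.
(* Midway between |x|^2 and 1, leaving room for y around x; the remaining width 1 - sqrt S0 serves
   as X0. *)
pose S0 := (sqnorm x + 1) / 2.
have S00 : 0 < S0 by rewrite /S0; lra.
have S01 : S0 < 1 by rewrite /S0; lra.
have q1 : Num.sqrt S0 < 1 by rewrite -sqrtr1 ltr_sqrt.
have [|eps eps0 yS] := @sqnorm_open R m x S0; first by rewrite /S0; lra.
exists (Num.min eps (1 - Num.sqrt S0)) => [|y0 y].
  by rewrite lt_min eps0 subr_gt0.
rewrite lt_min => /andP[_ y0X] yx A.
have -> : (2 * k + m - 1 = 2 * N)%N by lia.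
apply: (Ft_CK alpha hN hP monP (X0 := 1 - Num.sqrt S0) (S0 := S0)) => //.
- by rewrite subr_gt0.
- exact: ltW.
- by rewrite subrK.
- exact: ltW.
- by apply: yS => j; have := yx j; rewrite lt_min => /andP[].
Qed.
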